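(* Let $n\ge 1$ and $m\in\mathbb{N}$. For every tuple $\bar g=(g_1,\dots,g_m)$ of polynomials $g_i\in\mathbb{R}[\bar X]$ such that the quadratic module $M(\bar g)$ is archimedean and $\emptyset\neq S(\bar g)\subseteq(-1,1)^n$, there is some $c>0$ (depending on $\bar g$) such that for all $f\in\mathbb{R}[\bar X]$ of degree $d$ with minimum $f^*$ on $S(\bar g)$ and for all integers $k>c\exp((2d^2n^d)^c)$, we have $$(f-f^* )+\frac{6d^3n^{2d}\|f\|}{\sqrt[c]{\log\frac kc}}\in M(\bar g,k)$$ and hence $$0\le f^*-f_k^*\le\frac{6d^3n^{2d}\|f\|}{\sqrt[c]{\log\frac kc}},$$ where $f_k^*:=\sup\{a\in\mathbb{R}\mid f-a\in M(\bar g,k)\}\in\mathbb{R}\cup\{-\infty\}$.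
   Context: $\mathbb{N}=\{0,1,2,\dots\}$. $\mathbb{R}[\bar X]$ is the ring of real polynomials in $n\ge 1$ indeterminates $\bar X=(X_1,\dots,X_n)$, and $\sum\mathbb{R}[\bar X]^2$ is the set of (finite) sums of squares of polynomials in $\mathbb{R}[\bar X]$. For a tuple $\bar g=(g_1,\dots,g_m)$ of polynomials put $g_0:=1$ and $$S(\bar g):=\{x\in\mathbb{R}^n\mid g_1(x)\ge 0,\dots,g_m(x)\ge 0\},\qquad M(\bar g):=\left\{\sum_{i=0}^m\sigma_ig_i\;\middle|\;\sigma_i\in\sum\mathbb{R}[\bar X]^2\right\}.$$ $M(\bar g)$ is called the quadratic module generated by $\bar g$. It is archimedean if $N-\sum_{i=1}^nX_i^2\in M(\bar g)$ for some $N\in\mathbb{N}$. For real $k\ge 0$, $$M(\bar g,k):=\left\{\sum_{i=0}^m\sigma_ig_i\;\middle|\;\sigma_i\in\sum\mathbb{R}[\bar X]^2,\ \deg(\sigma_ig_i)\le k\text{ for all }i\right\}$$ (the zero polynomial satisfies every such degree bound). For $\alpha\in\mathbb{N}^n$ put $|\alpha|=\alpha_1+\dots+\alpha_n$, $\bar X^\alpha=X_1^{\alpha_1}\cdots X_n^{\alpha_n}$ and $\binom{|\alpha|}{\alpha}=\frac{|\alpha|!}{\alpha_1!\cdots\alpha_n!}$. For $f=\sum_\alpha a_\alpha\bar X^\alpha$ with $a_\alpha\in\mathbb{R}$, the norm is $\|f\|:=\max_\alpha |a_\alpha|/\binom{|\alpha|}{\alpha}$. The degree of a polynomial is its total degree.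 $\log$ is the natural logarithm, and $\sqrt[c]{t}:=t^{1/c}$ for real $t>0$, $c>0$. *)

(* Defs.v *)
(* mpoly must be imported before the analysis library: in the opposite order
   their notations clash. *)
From mathcomp Require Import all_boot all_order all_algebra.
From mathcomp Require Import mpoly.
From mathcomp Require Import all_classical all_reals all_analysis.

Set Implicit Arguments.
Unset Strict Implicit.
Unset Printing Implicit Defensive.

Import Order.TTheory GRing.Theory Num.Theory.

Local Open Scope ring_scope.
Local Open Scope classical_set_scope.

Section Defs.
Variables (R : realType) (n : nat).

(* [msize] is the total degree plus one, and 0 on the zero polynomial, so the
   zero polynomial is given degree 0 here. *)
Definition tdeg (p : {mpoly R[n]}) : nat := (msize p).-1.

Definition multinomial_coef (a : 'X_{1..n}) : R :=
  (mdeg a)`!%:R / \prod_(i < n) (a i)`!%:R.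

(* The maximum over all exponents is attained on the (finite) support, the
   other coefficients being zero; the zero polynomial has norm 0. *)
Definition poly_norm (f : {mpoly R[n]}) : R :=
  \big[Num.max/0]_(a <- msupp f) (`|f@_a| / multinomial_coef a).

Definition sums_of_squares : set {mpoly R[n]} :=
  [set p | exists s : seq {mpoly R[n]}, p = \sum_(q <- s) q ^+ 2].

Definition open_cube : set ('I_n -> R) :=
  [set x | forall i, -1 < x i < 1].

Definition is_minimum (S : set ('I_n -> R)) (f : {mpoly R[n]}) (fmin : R) :=
  (exists2 x, S x & f.@[x] = fmin) /\ (forall x, S x -> fmin <= f.@[x]).

Variable m : nat.
Implicit Types g : m.-tuple {mpoly R[n]}.

Definition basic_set g : set ('I_n -> R) :=
  [set x | forall i, 0 <= (tnth g i).@[x]].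

(* (g_0, g_1, ..., g_m) with g_0 = 1 *)
Definition with_one g : m.+1.-tuple {mpoly R[n]} := [tuple of 1 :: g].

Definition quadratic_module g : set {mpoly R[n]} :=
  [set p | exists sigma : 'I_m.+1 -> {mpoly R[n]},
    (forall i, sums_of_squares (sigma i)) /\
    p = \sum_(i < m.+1) sigma i * tnth (with_one g) i].

(* Meaningful for [0 <= k]; then the zero polynomial meets the degree bound. *)
Definition truncated_quadratic_module g (k : R) : set {mpoly R[n]} :=
  [set p | exists sigma : 'I_m.+1 -> {mpoly R[n]},
    [/\ forall i, sums_of_squares (sigma i),
        forall i, (tdeg (sigma i * tnth (with_one g) i))%:R <= k
      & p = \sum_(i < m.+1) sigma i * tnth (with_one g) i]].

Definition archimedean_module (M : set {mpoly R[n]}) : Prop :=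
  exists N : nat, M (N%:R - \sum_(i < n) 'X_i ^+ 2).

(* The value is -oo when no such [a] exists. *)
Definition sos_lower_bound g (f : {mpoly R[n]}) (k : R) : \bar R :=
  ereal_sup [set a%:E | a in
    [set a : R | truncated_quadratic_module g k (f - a%:MP)]].

End Defs.

(* Main.v *)
Require Import Defs.
From mathcomp Require Import all_boot all_order all_algebra.
From mathcomp Require Import mpoly.
From mathcomp Require Import all_classical all_reals all_analysis.
From mathcomp Require ordered_qelim qe_rcf polyrcf.
From mathcomp Require Import ring lra zify.

Set Implicit Arguments.
Unset Strict Implicit.
Unset Printing Implicit Defensive.

Import Order.TTheory GRing.Theory Num.Theory.

Local Open Scope ring_scope.
Local Open Scope classical_set_scope.

(** Adding the error term to f - f^* and dividing by it gives a polynomial p that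
    is at least 1 on S and whose degree and coefficient sum are at most
    t = 3 tau, where tau is the denominator log (k / c) ^ (1 / c) of the error
    term; here the coefficient sum of f is controlled by its norm because the
    multinomial coefficients of degree j add up to n ^ j.  Everything then rests
    on [putinar_degree_bound]: such a p lies in the quadratic module truncated at
    degree C exp (C t ^ K), with C and K depending only on g.  A large enough c
    makes this at most c exp (tau ^ c) = k.

    The certificate for p is found in two moves ([truncated_penalized]).  First,
    p is replaced by h = p - lam * sum_i (1 - g_i) ^ (2 j) g_i, with the g_i scaled
    to have absolute value at most 1 on the box [-1, 1]^n.  Where g_i >= 0 the
    corresponding term is at most lam / (2 j); where some g_i is at most - delta
    it is at most - lam delta, which outweighs p if lam is large.  So h is
    positive on the whole box, and p - h visibly lies in the module.  Secondly, a
    polynomial positive on a box has nonnegative Bernstein coefficients of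
    sufficiently high order; the Bernstein basis polynomials of even order are
    squares times products of the polynomials 1 - X_i ^ 2, one for each subset of
    the variables, and these finitely many products belong to the module.

    How large lam and j must be depends on delta: points of the box where
    p < 1/2 are at distance at least 1 / (2 t ^ 2) from S, p being Lipschitz, and
    one needs some g_i <= - delta there with 1 / delta polynomial in t.  This is
    the Lojasiewicz inequality [lojasiewicz].  Its proof applies quantifier
    elimination to the relation saying that some point of the box violates no
    constraint by more than e and has squared distance at least s to S; the
    supremum of these s is then a root, for each e > 0, of one fixed nonzero
    bivariate polynomial, and it tends to 0 with e by compactness, so that it is
    bounded by a power of e ([semialgebraic_growth]).

    That the products of the 1 - X_i ^ 2 are in the module is the qualitative
    form of Putinar's theorem, obtained from the same two moves on a large box
    [-r, r]^n, with compactness in place of the Lojasiewicz inequality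
    ([putinar_of_box]).  There the products of the r ^ 2 - X_i ^ 2 are easy: they
    lie in the quadratic module generated by the single polynomial
    N - sum_i X_i ^ 2, which is closed under multiplication
    ([ball_box_product]).

    The degree is exponential in a power of t because h has a coefficient sum
    exponential in j, while the order of the Bernstein expansion has to be
    proportional to that sum. *)

(** * Sums of squares and truncated quadratic modules *)

Section Degree.
Variables (R : realType) (n : nat).
Implicit Types p q : {mpoly R[n]}.

Lemma tdegC (c : R) : tdeg (c%:MP : {mpoly R[n]}) = 0%N.
Proof. by rewrite /tdeg msizeC; case: (c == 0). Qed.

Lemma tdegD_le p q k : (tdeg p <= k)%N -> (tdeg q <= k)%N -> (tdeg (p + q) <= k)%N.
Proof.
rewrite /tdeg -!subn1 !leq_subLR => hp hq.
by apply: (leq_trans (mmeasureD_le mdeg _ _)); rewrite geq_max hp hq.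
Qed.

Lemma tdegM_le p q j k :
  (tdeg p <= j)%N -> (tdeg q <= k)%N -> (tdeg (p * q) <= j + k)%N.
Proof.
rewrite /tdeg; have [->|p0] := eqVneq p 0; first by rewrite mul0r msize0.
have [->|q0] := eqVneq q 0; first by rewrite mulr0 msize0.
rewrite msizeM // => hp hq.
move: p0 q0 hp hq; rewrite -!(msize_poly_eq0 (n := n) (R := R)) -!lt0n.
by move: (msize p) (msize q) => a b; lia.
Qed.

Lemma tdegN p : tdeg (- p) = tdeg p.
Proof. by rewrite /tdeg msizeN. Qed.

Lemma tdegZ_le (c : R) p : (tdeg (c *: p) <= tdeg p)%N.
Proof. by rewrite /tdeg -!subn1 leq_sub2r // msizeZ_le. Qed.

Lemma tdegX (i : 'I_n) : tdeg ('X_i : {mpoly R[n]}) = 1%N.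
Proof. by rewrite /tdeg msizeX mdeg1. Qed.

Lemma tdegXn_le p j k : (tdeg p <= j)%N -> (tdeg (p ^+ k) <= k * j)%N.
Proof.
move=> hp; elim: k => [|k IH]; first by rewrite expr0 -mpolyC1 tdegC.
by rewrite exprS mulSn; apply: tdegM_le.
Qed.

Lemma tdeg_sum_le I (s : seq I) (P : pred I) (F : I -> {mpoly R[n]}) k :
  (forall i, P i -> (tdeg (F i) <= k)%N) -> (tdeg (\sum_(i <- s | P i) F i) <= k)%N.
Proof.
move=> hF; apply: (big_ind (fun p => (tdeg p <= k)%N)) => //.
  by rewrite -mpolyC0 tdegC.
by move=> p q; exact: tdegD_le.
Qed.

Lemma tdeg_prod_le (I : finType) (P : pred I) (F : I -> {mpoly R[n]}) k :
  (forall i, P i -> (tdeg (F i) <= k)%N) ->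
  (tdeg (\prod_(i | P i) F i) <= #|I| * k)%N.
Proof.
move=> hF; apply: (@leq_trans (\sum_(i : I | P i) k)%N); last first.
  rewrite big_mkcond /=.
  apply: (@leq_trans (\sum_(i : I) k)%N); last by rewrite sum_nat_const.
  by apply: leq_sum => i _; case: (P i).
apply: (big_ind2 (fun p j => (tdeg p <= j)%N)) => //.
  by rewrite -mpolyC1 tdegC.
by move=> p j q l; exact: tdegM_le.
Qed.

End Degree.

Section SumsOfSquares.
Variables (R : realType) (n : nat).
Implicit Types p q : {mpoly R[n]}.

Local Notation SOS := (@sums_of_squares R n).

Lemma sos0 : SOS 0.
Proof. by exists [::]; rewrite big_nil. Qed.

Lemma sos_sqr q : SOS (q ^+ 2).
Proof. by exists [:: q]; rewrite big_seq1. Qed.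

Lemma sosD p q : SOS p -> SOS q -> SOS (p + q).
Proof. by move=> [s ->] [t ->]; exists (s ++ t); rewrite big_cat. Qed.

Lemma sos_sqrM q p : SOS p -> SOS (q ^+ 2 * p).
Proof.
move=> [s ->]; exists [seq q * r | r <- s].
by rewrite big_map mulr_sumr; apply: eq_bigr => r _; rewrite exprMn.
Qed.

Lemma sosM p q : SOS p -> SOS q -> SOS (p * q).
Proof.
move=> [s ->] hq; rewrite mulr_suml.
apply: (big_ind SOS); [exact: sos0 | exact: sosD |].
by move=> r _; apply: sos_sqrM.
Qed.

Lemma sos1 : SOS 1.
Proof. by rewrite -[1](expr1n _ 2); exact: sos_sqr. Qed.

Lemma sosC (c : R) : 0 <= c -> SOS c%:MP.
Proof.
move=> c0; have -> : c%:MP = (Num.sqrt c)%:MP ^+ 2 :> {mpoly R[n]}.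
  by rewrite expr2 -mpolyCM -expr2 sqr_sqrtr.
exact: sos_sqr.
Qed.

Lemma sosZ (c : R) p : 0 <= c -> SOS p -> SOS (c *: p).
Proof. by move=> c0 hp; rewrite -mul_mpolyC; apply: sosM => //; exact: sosC. Qed.

Lemma sos_ge0 p x : SOS p -> 0 <= p.@[x].
Proof.
move=> [s ->]; rewrite raddf_sum; apply: sumr_ge0 => q _ /=.
by rewrite rmorphXn /= sqr_ge0.
Qed.

End SumsOfSquares.

Section TruncatedModule.
Variables (R : realType) (n m : nat) (g : m.-tuple {mpoly R[n]}).
Implicit Types p q : {mpoly R[n]}.

Local Notation TM k := (truncated_quadratic_module g k%:R).
Local Notation SOS := (@sums_of_squares R n).

Lemma truncatedW j k p : (j <= k)%N -> TM j p -> TM k p.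
Proof.
move=> jk [s [h1 h2 h3]]; exists s; split=> // i.
by apply: (le_trans (h2 i)); rewrite ler_nat.
Qed.

Lemma truncated0 k : TM k 0.
Proof.
exists (fun=> 0); split; first by move=> i; exact: sos0.
- by move=> i; rewrite mul0r -mpolyC0 tdegC ler_nat.
- by rewrite big1 // => i _; rewrite mul0r.
Qed.

Lemma truncatedD k p q : TM k p -> TM k q -> TM k (p + q).
Proof.
move=> [s [h1 h2 ->]] [t [k1 k2 ->]]; exists (fun i => s i + t i); split.
- by move=> i; apply: sosD.
- move=> i; rewrite mulrDl ler_nat; apply: tdegD_le; rewrite -(ler_nat R).
    exact: h2.
  exact: k2.
- by rewrite -big_split; apply: eq_bigr => i _; rewrite mulrDl.
Qed.

Lemma truncated_sum I (s : seq I) (P : pred I) (F : I -> {mpoly R[n]}) k :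
  (forall i, P i -> TM k (F i)) -> TM k (\sum_(i <- s | P i) F i).
Proof.
move=> hF; apply: (big_ind (fun p => TM k p)) => //.
  exact: truncated0.
by move=> p q; exact: truncatedD.
Qed.

Lemma truncated_sosM j k q p :
  SOS q -> (tdeg q <= j)%N -> TM k p -> TM (j + k) (q * p).
Proof.
move=> sq hq [s [h1 h2 ->]]; exists (fun i => q * s i); split.
- by move=> i; apply: sosM.
- move=> i; rewrite ler_nat -mulrA; apply: tdegM_le => //.
  by rewrite -(ler_nat R); exact: h2.
- by rewrite mulr_sumr; apply: eq_bigr => i _; rewrite mulrA.
Qed.

Lemma truncatedZ k (c : R) p : 0 <= c -> TM k p -> TM k (c *: p).
Proof.
move=> c0 hp; rewrite -mul_mpolyC -[k]add0n.
by apply: truncated_sosM => //; [exact: sosC | rewrite tdegC].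
Qed.

Lemma truncated_with_one k q (i : 'I_m.+1) : SOS q ->
  (tdeg (q * tnth (with_one g) i) <= k)%N -> TM k (q * tnth (with_one g) i).
Proof.
move=> sq hq; exists (fun j => if j == i then q else 0); split.
- by move=> j; case: eqP => // _; exact: sos0.
- move=> j; rewrite ler_nat; case: eqP => [->|_] //.
  by rewrite mul0r -mpolyC0 tdegC.
- rewrite (bigD1 i) //= eqxx big1 ?addr0 // => j /negPf ->.
  by rewrite mul0r.
Qed.

Lemma truncated_gen k q (i : 'I_m) : SOS q ->
  (tdeg (q * tnth g i) <= k)%N -> TM k (q * tnth g i).
Proof.
have -> : tnth g i = tnth (with_one g) (lift ord0 i) by rewrite tnthS.
exact: truncated_with_one.
Qed.

Lemma truncated_sos k q : SOS q -> (tdeg q <= k)%N -> TM k q.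
Proof.
move=> sq hq; have := @truncated_with_one k q ord0 sq.
by rewrite tnth0 mulr1; apply.
Qed.

Lemma truncated_ge0 (k : R) p x :
  truncated_quadratic_module g k p -> basic_set g x -> 0 <= p.@[x].
Proof.
move=> [s [h1 _ ->]] Sx; rewrite raddf_sum; apply: sumr_ge0 => i _ /=.
rewrite mevalM; apply: mulr_ge0; first exact: sos_ge0.
case: (unliftP ord0 i) => [j ->|->]; first by rewrite tnthS; exact: (Sx j).
by rewrite tnth0 meval1.
Qed.

Lemma quadratic_module_truncated p : quadratic_module g p -> exists k, TM k p.
Proof.
move=> [s [h1 ->]]; exists (\max_i tdeg (s i * tnth (with_one g) i))%N.
exists s; split=> // i; rewrite ler_nat.
exact: (leq_bigmax (F := fun i => tdeg (s i * tnth (with_one g) i))).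
Qed.

End TruncatedModule.

(** * Bernstein expansions on a box *)

Section UnitProducts.
Variable R : realType.

Lemma dist_mul_le1 (a b c d : R) : `|a| <= 1 -> `|d| <= 1 ->
  `|a * c - b * d| <= `|a - b| + `|c - d|.
Proof.
move=> ha hd; have -> : a * c - b * d = a * (c - d) + (a - b) * d by ring.
apply: (le_trans (ler_normD _ _)); rewrite !normrM addrC.
by apply: lerD; [rewrite ler_piMr | rewrite ler_piMl].
Qed.

Lemma norm_prod_le1 (I : Type) (s : seq I) (a : I -> R) :
  (forall i, `|a i| <= 1) -> `|\prod_(i <- s) a i| <= 1.
Proof.
move=> ha; rewrite normr_prod; elim: s => [|i s IH]; first by rewrite big_nil.
by rewrite big_cons mulr_ile1 // prodr_ge0.
Qed.

Lemma dist_prod_le1 (I : Type) (s : seq I) (a b : I -> R) :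
  (forall i, `|a i| <= 1) -> (forall i, `|b i| <= 1) ->
  `|\prod_(i <- s) a i - \prod_(i <- s) b i| <= \sum_(i <- s) `|a i - b i|.
Proof.
move=> ha hb; elim: s => [|i s IH]; first by rewrite !big_nil subrr normr0.
rewrite !big_cons; apply: (le_trans (dist_mul_le1 _ _ _ _)) => //.
  exact: norm_prod_le1.
by rewrite lerD2l.
Qed.

End UnitProducts.

Section Bernstein.
Variable R : realType.

(** The coefficient of the j-th Bernstein basis polynomial of order N in the
    expansion of the monomial of degree a. *)
Definition bernstein_weight (N a j : nat) : R := 'C(j, a)%:R / 'C(N, a)%:R.

Lemma bin_mul_bin N a l : (a + l <= N)%N ->
  ('C(N, a + l) * 'C(a + l, a) = 'C(N, a) * 'C(N - a, l))%N.
Proof.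
move=> h; have aN : (a <= N)%N by lia.
have hl : (l <= N - a)%N by lia.
have hal : (a <= a + l)%N by lia.
have e1 := bin_fact h; have e2 := bin_fact hal.
have e3 := bin_fact aN; have e4 := bin_fact hl.
move: e2 e4; rewrite addKn (_ : N - a - l = N - (a + l))%N; last by lia.
move=> e2 e4; have f1 := fact_gt0 a; have f2 := fact_gt0 l.
have f3 := fact_gt0 (N - (a + l)).
apply/eqP; rewrite -(@eqn_pmul2r (a`! * l`! * (N - (a + l))`!)%N) ?muln_gt0 ?f1 ?f2 //.
apply/eqP; transitivity N`!%N.
  by rewrite -e1 -e2; ring.
by rewrite -e3 -e4; ring.
Qed.

(** Expand the right-hand side of U ^ a = U ^ a ((1 - U) + U) ^ (N - a) by the
    binomial theorem, and use C(N, j) C(j, a) = C(N, a) C(N - a, j - a). *)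
Lemma bernstein_monomial (n N a : nat) (U : {mpoly R[n]}) : (a <= N)%N ->
  U ^+ a = \sum_(j < N.+1) bernstein_weight N a j *:
             (U ^+ j * (1 - U) ^+ (N - j) *+ 'C(N, j)).
Proof.
move=> aN; rewrite -(big_mkord xpredT (fun j => bernstein_weight N a j *:
             (U ^+ j * (1 - U) ^+ (N - j) *+ 'C(N, j)))).
rewrite (big_cat_nat (n := a)) //=; last by lia.
rewrite [X in X + _]big_nat big1 ?add0r; last first.
  by move=> j /andP[_ ja]; rewrite /bernstein_weight bin_small // mul0r scale0r.
have -> : U ^+ a = U ^+ a * ((1 - U) + U) ^+ (N - a).
  by rewrite subrK expr1n mulr1.
rewrite exprDn mulr_sumr -[X in \sum_(X <= _ < _) _]add0n big_addn.
have -> : (N.+1 - a = (N - a).+1)%N by lia.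
rewrite big_mkord; apply: eq_bigr => l _.
have hl : (l + a <= N)%N by have := ltn_ord l; lia.
rewrite /bernstein_weight -[X in _ = _ *: X]scaler_nat scalerA.
have -> : ('C(l + a, a))%:R / ('C(N, a))%:R * ('C(N, l + a))%:R = 'C(N - a, l)%:R :> R.
  have C0 : ('C(N, a))%:R != 0 :> R by rewrite pnatr_eq0 -lt0n bin_gt0.
  apply: (mulfI C0); rewrite -natrM -bin_mul_bin; last by lia.
  by rewrite addnC natrM; field.
rewrite scaler_nat !mulrnAr; congr (_ *+ _).
by rewrite exprD -subnDA [(l + a)%N]addnC mulrCA mulrC [U ^+ a * _]mulrC.
Qed.

Lemma bernstein_weight_le1 N a j : (j <= N)%N -> (a <= N)%N ->
  0 <= bernstein_weight N a j <= 1.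
Proof.
move=> jN aN; rewrite /bernstein_weight divr_ge0 //=.
rewrite ler_pdivrMr ?mul1r ?ler_nat ?leq_bin2l //.
by rewrite ltr0n bin_gt0.
Qed.

Lemma bernstein_weightS N a j : (a < N)%N ->
  bernstein_weight N a.+1 j = bernstein_weight N a j * ((j - a)%:R / (N - a)%:R).
Proof.
move=> aN; rewrite /bernstein_weight.
have hN : ('C(N, a.+1) * a.+1 = 'C(N, a) * (N - a))%N.
  by rewrite mulnC mul_bin_left mulnC.
have hj : ('C(j, a.+1) * a.+1 = 'C(j, a) * (j - a))%N.
  by rewrite mulnC mul_bin_left mulnC.
have C0 : ('C(N, a))%:R != 0 :> R by rewrite pnatr_eq0 -lt0n bin_gt0 ltnW.
have C1 : ('C(N, a.+1))%:R != 0 :> R by rewrite pnatr_eq0 -lt0n bin_gt0.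
have C2 : (N - a)%:R != 0 :> R by rewrite pnatr_eq0 -lt0n subn_gt0.
have C3 : (a.+1)%:R != 0 :> R by rewrite pnatr_eq0.
move/(congr1 (fun k => k%:R : R)): hN; move/(congr1 (fun k => k%:R : R)): hj.
rewrite !natrM => hj hN.
rewrite mulf_div -hN -hj -mulf_div divff // mulr1 //.
Qed.

(** Passing from a to a + 1 multiplies the weight by (j - a) / (N - a) and the power
    by j / N, two numbers of [0, 1] at distance at most a / N. *)
Lemma bernstein_weight_approx N a j : (j <= N)%N -> (a <= N)%N -> (0 < N)%N ->
  `|bernstein_weight N a j - (j%:R / N%:R) ^+ a| <= (a ^ 2)%:R / N%:R.
Proof.
move=> jN aN N0; elim: a aN => [|a IH] aN.
  by rewrite /bernstein_weight !bin0 expr0 divff // subrr normr0 mul0r.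
have NR : 0 < N%:R :> R by rewrite ltr0n.
rewrite bernstein_weightS // exprSr.
have x01 : 0 <= (j%:R / N%:R : R) <= 1.
  by rewrite divr_ge0 //= ler_pdivrMr // mul1r ler_nat.
have w01 := bernstein_weight_le1 jN (ltnW aN).
apply: (le_trans (dist_mul_le1 _ _ _ _)).
- by rewrite ger0_norm; case/andP: w01.
- by rewrite ger0_norm; case/andP: x01.
have step : `|(j - a)%:R / (N - a)%:R - j%:R / N%:R| <= a%:R / N%:R :> R.
  have Na0 : 0 < (N - a)%:R :> R by rewrite ltr0n subn_gt0.
  have [aj|ja] := leqP a j; last first.
    rewrite (_ : j - a = 0)%N ?mul0r; last by lia.
    by rewrite sub0r normrN ger0_norm ?ler_pM2r ?invr_gt0 ?ler_nat ?(ltnW ja) //; case/andP: x01.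
  rewrite natrB // natrB ?(ltnW aN) //; rewrite natrB ?(ltnW aN) // in Na0.
  have -> : (j%:R - a%:R) / (N%:R - a%:R) - j%:R / N%:R =
            - (a%:R / N%:R * ((N%:R - j%:R) / (N%:R - a%:R))) :> R.
    by field; rewrite gt_eqF //= gt_eqF.
  have jN' : j%:R <= N%:R :> R by rewrite ler_nat.
  have aj' : a%:R <= j%:R :> R by rewrite ler_nat.
  have q01 : 0 <= ((N%:R - j%:R) / (N%:R - a%:R) : R) <= 1.
    rewrite ler_pdivrMr // divr_ge0 ?(ltW Na0) /= ?mul1r ?subr_ge0 //.
    by rewrite lerD2l lerN2.
  case/andP: q01 => q0 q1.
  rewrite normrN ger0_norm; last by rewrite mulr_ge0 // divr_ge0.
  by rewrite ler_piMr // divr_ge0.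
apply: (le_trans (lerD (IH (ltnW aN)) step)).
rewrite -mulrDl ler_pM2r ?invr_gt0 // -natrD ler_nat; lia.
Qed.

End Bernstein.

Section BoxExpansion.
Variables (R : realType) (n : nat).
Implicit Types p q : {mpoly R[n]}.

Definition box (r : R) : set ('I_n -> R) := [set x | forall i, - r <= x i <= r].

Definition box_coord (r : R) (i : 'I_n) : {mpoly R[n]} :=
  (2 * r)^-1 *: (r%:MP + 'X_i).

(** The coordinates [box_coord r i] send the box [-r, r]^n to [0, 1]^n, and A bounds
    the sum of the absolute values of the coefficients of p in these
    coordinates.  As an upper bound rather than an exact sum, A is compatible
    with sums and products although expansions are not unique. *)
Definition box_expansion (r : R) (D : nat) (A : R) p :=
  exists s : seq (R * 'X_{1..n}),
    [/\ p = \sum_(t <- s) t.1 *: \prod_i box_coord r i ^+ t.2 i,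
        forall t, t \in s -> (mdeg t.2 <= D)%N
      & \sum_(t <- s) `|t.1| <= A].

Lemma box_expansionW r D D' A A' p : (D <= D')%N -> A <= A' ->
  box_expansion r D A p -> box_expansion r D' A' p.
Proof.
move=> hD hA [s [e d a]]; exists s; split=> //.
- by move=> t /d /leq_trans; apply.
- exact: le_trans hA.
Qed.

Lemma box_expansionC r (c : R) : box_expansion r 0 `|c| c%:MP.
Proof.
exists [:: (c, 0%MM)]; split.
- rewrite big_seq1 /= big1 => [|i _]; last by rewrite mnm0E expr0.
  by rewrite -mul_mpolyC mulr1.
- by move=> t; rewrite inE => /eqP ->; rewrite mdeg0.
- by rewrite big_seq1.
Qed.

Lemma box_expansionD r D A B p q : box_expansion r D A p ->
  box_expansion r D B q -> box_expansion r D (A + B) (p + q).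
Proof.
move=> [s [es ds as_]] [t [et dt at_]]; exists (s ++ t); split.
- by rewrite big_cat es et.
- by move=> u; rewrite mem_cat => /orP[/ds|/dt].
- by rewrite big_cat lerD.
Qed.

Lemma box_expansionM r D E A B p q : 0 <= A -> box_expansion r D A p ->
  box_expansion r E B q -> box_expansion r (D + E) (A * B) (p * q).
Proof.
move=> A0 [s [es ds as_]] [t [et dt at_]].
exists [seq (u.1 * v.1, (u.2 + v.2)%MM) | u <- s, v <- t]; split.
- rewrite big_allpairs_dep es et mulr_suml; apply: eq_bigr => u _.
  rewrite mulr_sumr; apply: eq_bigr => v _ /=.
  rewrite -scalerAl -scalerAr scalerA -big_split /=; congr (_ *: _).
  by apply: eq_bigr => i _; rewrite mnmDE exprD.
- by move=> w /allpairsP[[u v] /= [us vt ->]] /=; rewrite mdegD leq_add ?ds ?dt.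
- rewrite big_allpairs_dep /=.
  under eq_bigr do (under eq_bigr do rewrite normrM; rewrite -mulr_sumr).
  rewrite -mulr_suml; apply: ler_pM => //; apply: sumr_ge0 => *; exact: normr_ge0.
Qed.

Lemma box_expansionZ r D A (c : R) p : box_expansion r D A p ->
  box_expansion r D (`|c| * A) (c *: p).
Proof.
move=> hp; rewrite -mul_mpolyC -[D]add0n.
by apply: box_expansionM => //; exact: box_expansionC.
Qed.

Lemma box_expansion_exp r D A k p : 0 <= A -> box_expansion r D A p ->
  box_expansion r (k * D) (A ^+ k) (p ^+ k).
Proof.
move=> A0 hp; elim: k => [|k IH].
  by have := box_expansionC r 1; rewrite normr1 mpolyC1.
by rewrite !exprS mulSn; apply: box_expansionM.
Qed.

Lemma box_expansion_sum r D I (s : seq I) (A : I -> R) (F : I -> {mpoly R[n]}) :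
  (forall i, box_expansion r D (A i) (F i)) ->
  box_expansion r D (\sum_(i <- s) A i) (\sum_(i <- s) F i).
Proof.
move=> h; elim: s => [|i s IH].
  rewrite !big_nil; have := box_expansionC r 0; rewrite normr0 mpolyC0.
  exact: box_expansionW.
by rewrite !big_cons; apply: box_expansionD.
Qed.

Lemma box_expansion_var r i : 0 < r -> box_expansion r 1 (3 * r) 'X_i.
Proof.
move=> r0; exists [:: (2 * r, U_(i)%MM); (- r, 0%MM)]; split.
- rewrite !big_cons big_nil addr0 /=.
  have -> : \prod_j box_coord r j ^+ (0%MM : 'X_{1..n}) j = 1.
    by rewrite big1 // => j _; rewrite mnm0E expr0.
  have -> : \prod_j box_coord r j ^+ U_(i)%MM j = box_coord r i.
    rewrite (bigD1 i) //= mnm1E eqxx expr1 big1 ?mulr1 // => j ji.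
    by rewrite mnm1E eq_sym (negPf ji) expr0.
  rewrite scalerA divff ?mulf_neq0 ?gt_eqF //.
  by rewrite scale1r -mul_mpolyC mulr1 mpolyCN addrAC subrr add0r.
- by move=> t; rewrite !inE => /orP[] /eqP -> /=; rewrite ?mdeg1 ?mdeg0.
- rewrite !big_cons big_nil addr0 /= normrN !gtr0_norm ?mulr_gt0 //.
  by rewrite le_eqVlt; apply/orP; left; apply/eqP; ring.
Qed.

Lemma box_expansion_monomial r (a : 'X_{1..n}) : 0 < r ->
  box_expansion r (mdeg a) ((3 * r) ^+ mdeg a) 'X_[a].
Proof.
move=> r0; rewrite mpolyXE_id mdegE -prodrXr.
elim: (index_enum _) => [|i s IH].
  by rewrite !big_nil; have := box_expansionC r 1; rewrite normr1 mpolyC1.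
rewrite !big_cons; apply: box_expansionM => //.
  by rewrite exprn_ge0 // mulr_ge0 // ltW.
rewrite -[a i in X in box_expansion _ X]muln1; apply: box_expansion_exp.
  by rewrite mulr_ge0 // ltW.
exact: box_expansion_var.
Qed.

End BoxExpansion.

Section BoxPositivity.
Variables (R : realType) (n : nat).
Implicit Types p q : {mpoly R[n]}.
Definition coef_norm p : R := \sum_(a <- msupp p) `|p@_a|.

Lemma coef_norm_ge0 p : 0 <= coef_norm p.
Proof. by apply: sumr_ge0. Qed.

Lemma mdeg_le_tdeg p a : a \in msupp p -> (mdeg a <= tdeg p)%N.
Proof. by move=> /msize_mdeg_lt; rewrite /tdeg; move: (msize p) => s; lia. Qed.

Variables (r : R) (r_gt0 : 0 < r).

(** In box coordinates X_i = 2 r U_i - r has coefficient sum 3 r, so a monomial of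
    degree e has coefficient sum (3 r) ^ e; the larger B allows for e < tdeg p. *)
Lemma box_expansion_mpoly B p : 1 <= B -> 3 * r <= B ->
  box_expansion r (tdeg p) (B ^+ tdeg p * coef_norm p) p.
Proof.
move=> B1 rB; rewrite {4}(mpolyE p) /coef_norm mulr_sumr !big_seq.
have step a : a \in msupp p ->
    box_expansion r (tdeg p) (B ^+ tdeg p * `|p@_a|) (p@_a *: 'X_[a]).
  move=> ha; have := box_expansionZ p@_a (box_expansion_monomial a r_gt0).
  apply: box_expansionW; first exact: mdeg_le_tdeg.
  rewrite mulrC ler_wpM2r //; apply: (@le_trans _ _ (B ^+ mdeg a)).
    by apply: lerXn2r; rewrite ?nnegrE ?mulr_ge0 ?(ltW r_gt0) // (le_trans _ B1).
  by rewrite ler_weXn2l // mdeg_le_tdeg.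
apply: (big_ind2 (fun q A => box_expansion r (tdeg p) A q)) => //.
  rewrite -mpolyC0; have := box_expansionC n r 0; rewrite normr0.
  exact: box_expansionW.
by move=> *; apply: box_expansionD.
Qed.

Lemma meval_box_coord (x : 'I_n -> R) i : (box_coord r i).@[x] = (r + x i) / (2 * r).
Proof. by rewrite mevalZ mevalD mevalC mevalXU mulrC. Qed.

Lemma box_coord_01 (x : 'I_n -> R) i : box r x -> 0 <= (r + x i) / (2 * r) <= 1.
Proof.
move=> /(_ i) /andP[h1 h2]; have r2 : 0 < 2 * r by rewrite mulr_gt0.
apply/andP; split; first by apply: divr_ge0; [lra | exact: ltW].
by rewrite ler_pdivrMr //; lra.
Qed.

Lemma meval_expansion (s : seq (R * 'X_{1..n})) (x : 'I_n -> R) :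
  (\sum_(t <- s) t.1 *: \prod_i box_coord r i ^+ t.2 i).@[x] =
  \sum_(t <- s) t.1 * \prod_i ((r + x i) / (2 * r)) ^+ t.2 i.
Proof.
rewrite raddf_sum; apply: eq_bigr => t _ /=; rewrite mevalZ; congr (_ * _).
rewrite rmorph_prod; apply: eq_bigr => i _ /=.
by rewrite rmorphXn /= meval_box_coord.
Qed.

Lemma box_expansion_bound D A p x : box_expansion r D A p -> box r x ->
  `|p.@[x]| <= A.
Proof.
move=> [s [-> _ sA]] bx; rewrite meval_expansion.
apply: le_trans sA; apply: (le_trans (ler_norm_sum _ _ _)).
apply: ler_sum => t _; rewrite normrM ler_piMr //.
apply: norm_prod_le1 => i; have /andP[h0 h1] := box_coord_01 i bx.
by rewrite ger0_norm ?exprn_ge0 // exprn_ile1.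
Qed.

Lemma tdeg_box_coord i : (tdeg (box_coord r i : {mpoly R[n]}) <= 1)%N.
Proof.
apply: (leq_trans (tdegZ_le _ _)); apply: tdegD_le; first by rewrite tdegC.
by rewrite tdegX.
Qed.

Lemma box_expansion_tdeg D A p : box_expansion r D A p -> (tdeg p <= D)%N.
Proof.
move=> [s [-> h _]]; rewrite big_seq; apply: tdeg_sum_le => t /h ht.
apply: (leq_trans (tdegZ_le _ _)); apply: leq_trans ht; rewrite mdegE.
apply: (big_ind2 (fun (q : {mpoly R[n]}) j => (tdeg q <= j)%N)).
- by rewrite -mpolyC1 tdegC.
- by move=> ? ? ? ?; exact: tdegM_le.
- move=> i _; rewrite -[X in (_ <= X)%N]muln1; apply: tdegXn_le.
  exact: tdeg_box_coord.
Qed.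

Lemma bernstein_prod_approx (N : nat) (a : 'X_{1..n}) (b : 'I_n -> nat) :
  (0 < N)%N -> (mdeg a <= N)%N -> (forall i, (b i <= N)%N) ->
  `|\prod_i bernstein_weight R N (a i) (b i) - \prod_i ((b i)%:R / N%:R) ^+ a i|
    <= (mdeg a ^ 2)%:R / N%:R.
Proof.
move=> N0 aN bN.
have ai i : (a i <= mdeg a)%N by rewrite mdegE (bigD1 i) //= leq_addr.
have aiN i : (a i <= N)%N by exact: leq_trans (ai i) aN.
have NR : 0 < N%:R :> R by rewrite ltr0n.
apply: (le_trans (dist_prod_le1 _ _ _)).
- move=> i; have /andP[h0 h1] := bernstein_weight_le1 R (bN i) (aiN i).
  by rewrite ger0_norm.
- move=> i; have h0 : 0 <= (b i)%:R / N%:R :> R by rewrite divr_ge0.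
  rewrite ger0_norm ?exprn_ge0 // exprn_ile1 // ler_pdivrMr // mul1r ler_nat //.
apply: (@le_trans _ _ (\sum_(i < n) (a i ^ 2)%:R / N%:R)).
  by apply: ler_sum => i _; apply: bernstein_weight_approx.
rewrite -mulr_suml ler_pM2r ?invr_gt0 // -natr_sum ler_nat.
rewrite -[leqRHS]mulnn {1}mdegE big_distrl /=.
by apply: leq_sum => i _; rewrite -mulnn leq_mul.
Qed.

(** The Bernstein coefficient with index w differs from the value of p at the grid
    point with coordinates w_i / N by at most A D ^ 2 / N, which is at most the
    lower bound mu of p on the box. *)
Lemma bernstein_expansion_ge0 D A (mu : R) N p :
  box_expansion r D A p -> (forall x, box r x -> mu <= p.@[x]) ->
  (0 < N)%N -> (D <= N)%N -> A * (D ^ 2)%:R <= mu * N%:R ->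
  exists2 b : {ffun 'I_n -> 'I_N.+1} -> R, forall w, 0 <= b w &
    p = \sum_w b w *: \prod_i (box_coord r i ^+ w i *
                                (1 - box_coord r i) ^+ (N - w i) *+ 'C(N, w i)).
Proof.
move=> [s [es ds sA]] pmu N0 DN hN.
have NR : 0 < N%:R :> R by rewrite ltr0n.
exists (fun w : {ffun 'I_n -> 'I_N.+1} =>
          \sum_(t <- s) t.1 * \prod_i bernstein_weight R N (t.2 i) (w i)).
  (* The point of the box whose box coordinates are the w i / N. *)
  move=> w; pose x i := 2 * r * ((w i)%:R / N%:R) - r.
  have xE i : (r + x i) / (2 * r) = (w i)%:R / N%:R.
    by rewrite /x; field; rewrite !gt_eqF.
  have bx : box r x.
    move=> i; have w01 : 0 <= ((w i)%:R / N%:R : R) <= 1.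
      by rewrite divr_ge0 //= ler_pdivrMr // mul1r ler_nat -ltnS.
    rewrite /x; move: w01; move: (_ / _) => u /andP[u0 u1].
    have h0 : 0 <= r * u by rewrite mulr_ge0 // ltW.
    have h1 : r * u <= r by rewrite ler_piMr // ltW.
    by rewrite -mulrA; apply/andP; split; lra.
  have := pmu x bx; rewrite es meval_expansion.
  under [X in _ <= X]eq_bigr do under eq_bigr do rewrite xE.
  move=> hmu.
  set B := \sum_(t <- s) _; set P := \sum_(t <- s) _ in hmu.
  have hdist : `|B - P| <= A * ((D ^ 2)%:R / N%:R).
    rewrite /B /P -sumrB; apply: (le_trans (ler_norm_sum _ _ _)).
    have D0 : 0 <= (D ^ 2)%:R / N%:R :> R by rewrite divr_ge0.
    apply: (@le_trans _ _ (\sum_(t <- s) `|t.1| * ((D ^ 2)%:R / N%:R))).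
      rewrite big_seq [leRHS]big_seq; apply: ler_sum => t ts.
      rewrite -mulrBr normrM ler_wpM2l //.
      apply: (le_trans (bernstein_prod_approx _ _ _)) => //.
      - by apply: leq_trans (ds _ ts) DN.
      - by move=> i; rewrite -ltnS.
      - by rewrite ler_pM2r ?invr_gt0 // ler_nat leq_exp2r // ds.
    by rewrite -mulr_suml ler_wpM2r.
  have : A * ((D ^ 2)%:R / N%:R) <= mu by rewrite mulrA ler_pdivrMr.
  by move: hdist; rewrite ler_norml => /andP[]; lra.
rewrite {1}es.
transitivity (\sum_(t <- s) \sum_(w : {ffun 'I_n -> 'I_N.+1})
   (t.1 * \prod_i bernstein_weight R N (t.2 i) (w i)) *:
     \prod_i (box_coord r i ^+ w i * (1 - box_coord r i) ^+ (N - w i) *+ 'C(N, w i))).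
  rewrite big_seq [RHS]big_seq; apply: eq_bigr => t ts.
  have tN i : (t.2 i <= N)%N.
    apply: leq_trans (leq_trans (ds _ ts) DN).
    by rewrite mdegE (bigD1 i) //= leq_addr.
  under eq_bigr do rewrite (bernstein_monomial _ (tN _)).
  rewrite bigA_distr_bigA /= scaler_sumr; apply: eq_bigr => w _.
  by rewrite scaler_prod scalerA.
rewrite exchange_big /=; apply: eq_bigr => w _.
by rewrite scaler_suml.
Qed.

End BoxPositivity.

Section BoxCone.
Variables (R : realType) (n m : nat) (g : m.-tuple {mpoly R[n]}).
Variables (r : R) (r_gt0 : 0 < r).
Implicit Types p q : {mpoly R[n]}.

Definition box_product (I : {set 'I_n}) : {mpoly R[n]} :=
  \prod_(i in I) ((r ^+ 2)%:MP - 'X_i ^+ 2).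

Lemma box_coord_mulC i :
  box_coord r i * (1 - box_coord r i) =
  (4 * r ^+ 2)^-1 *: ((r ^+ 2)%:MP - 'X_i ^+ 2) :> {mpoly R[n]}.
Proof.
have rn : r != 0 by rewrite gt_eqF.
have E : 1 - box_coord r i = (2 * r)^-1 *: (r%:MP - 'X_i) :> {mpoly R[n]}.
  have -> : 1 = (2 * r)^-1 *: (r%:MP + r%:MP) :> {mpoly R[n]}.
    rewrite -mpolyCD -mul_mpolyC -mpolyCM -mpolyC1; congr _%:MP.
    by field.
  by rewrite /box_coord -scalerBr opprD addrACA subrr add0r.
rewrite E /box_coord -scalerAl -scalerAr scalerA; congr (_ *: _); first by field.
by rewrite expr2 mpolyCM; ring.
Qed.

(** As the order is even, both exponents have the same parity. *)
Lemma bernstein_term_parity (M b : nat) (U : {mpoly R[n]}) : (b <= M.*2)%N ->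
  U ^+ b * (1 - U) ^+ (M.*2 - b) =
  (U ^+ b./2 * (1 - U) ^+ (M.*2 - b)./2) ^+ 2 *
    (if odd b then U * (1 - U) else 1).
Proof.
move=> bM; have := odd_double_half b; have := odd_double_half (M.*2 - b).
rewrite exprMn -!exprM !muln2 oddB // odd_double /=; case: (odd b) => /= e1 e2.
  by rewrite -{1}e2 -{1}e1 !exprD !expr1 mulrACA mulrC.
by rewrite mulr1 -{1}e2 -{1}e1 !add0n.
Qed.

(** Every term of the Bernstein expansion of order 2 M is a nonnegative multiple of
    a square, of degree at most 2 n M, times the product of the r ^ 2 - X_i ^ 2
    over the variables that have an odd exponent. *)
Lemma truncated_box_positive E D A (mu : R) M p :
  (forall I, truncated_quadratic_module g E%:R (box_product I)) ->
  box_expansion r D A p -> (forall x, box r x -> mu <= p.@[x]) ->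
  (0 < M)%N -> (D <= M.*2)%N -> A * (D ^ 2)%:R <= mu * (M.*2)%:R ->
  truncated_quadratic_module g (2 * (n * M) + E)%:R p.
Proof.
move=> hI hp pmu M0 DM hA.
have M2 : (0 < M.*2)%N by lia.
have [b b0 ->] := bernstein_expansion_ge0 r_gt0 hp pmu M2 DM hA.
apply: truncated_sum => w _; apply: truncatedZ => //.
pose s i : {mpoly R[n]} :=
  box_coord r i ^+ (w i)./2 * (1 - box_coord r i) ^+ (M.*2 - w i)./2.
pose I : {set 'I_n} := [set i | odd (w i)]%SET.
have -> : \prod_i (box_coord r i ^+ w i *
            (1 - box_coord r i) ^+ (M.*2 - w i) *+ 'C(M.*2, w i)) =
    (\prod_i 'C(M.*2, w i)%:R * \prod_(i in I) (4 * r ^+ 2)^-1) *: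
    ((\prod_i s i) ^+ 2 * box_product I) :> {mpoly R[n]}.
  rewrite -scalerA scalerAr -[X in _ * X]scaler_prod.
  have -> : \prod_(i in I) ((4 * r ^+ 2)^-1 *: ((r ^+ 2)%:MP - 'X_i ^+ 2)) =
            \prod_i (if odd (w i) then box_coord r i * (1 - box_coord r i) else 1)
            :> {mpoly R[n]}.
    rewrite big_mkcond; apply: eq_bigr => i _; rewrite inE.
    by case: (odd _) => //; rewrite box_coord_mulC.
  rewrite -prodrXl -big_split /= -scaler_prod; apply: eq_bigr => i _.
  rewrite scaler_nat; congr (_ *+ _); apply: bernstein_term_parity.
  by rewrite -ltnS.
apply: truncatedZ.
  rewrite mulr_ge0 ?prodr_ge0 // => i _.
  by rewrite invr_ge0 mulr_ge0 // sqr_ge0.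
apply: truncated_sosM => //; first exact: sos_sqr.
apply: tdegXn_le; rewrite -[X in (X * _)%N]card_ord; apply: tdeg_prod_le => i _.
have h1 := tdeg_box_coord r i.
have h2 : (tdeg (1 - box_coord r i : {mpoly R[n]}) <= 1)%N.
  by apply: tdegD_le; [rewrite -mpolyC1 tdegC | rewrite tdegN].
apply: leq_trans (tdegM_le (tdegXn_le _ h1) (tdegXn_le _ h2)) _.
by have := ltn_ord (w i); lia.
Qed.

End BoxCone.

(** * Penalisation of the constraints *)

Section Penalty.
Variable R : realType.

(** For nonnegative t this follows from Bernoulli's inequality, since
    (1 - t) ^ j (1 + t) ^ j <= 1. *)
Lemma penalty_le (j : nat) (t : R) : `|t| <= 1 -> j%:R * ((1 - t) ^+ j * t) <= 1.
Proof.
rewrite ler_norml => /andP[t1 t2].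
have [t0|t0] := lerP 0 t; last first.
  apply: (@le_trans _ _ 0) => //; rewrite mulr_ge0_le0 // mulr_ge0_le0 ?(ltW t0) //.
  by rewrite exprn_ge0 //; lra.
have bern : 1 + j%:R * t <= (1 + t) ^+ j.
  elim: j => [|j IH]; first by rewrite mul0r addr0 expr0.
  rewrite exprS -natr1; have := ler_wpM2l (addr_ge0 ler01 t0) IH.
  apply: le_trans; rewrite -subr_ge0.
  have -> : (1 + t) * (1 + j%:R * t) - (1 + (j%:R + 1) * t) = j%:R * (t * t) by ring.
  by rewrite mulr_ge0 // mulr_ge0.
have p0 : 0 <= (1 - t) ^+ j by rewrite exprn_ge0 //; lra.
have h : (1 - t) ^+ j * (1 + t) ^+ j <= 1.
  by rewrite -exprMn exprn_ile1 //; nra.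
have := ler_wpM2l p0 bern; nra.
Qed.

Lemma penalty_neg (k : nat) (t d : R) : 0 <= d -> t <= - d ->
  (1 - t) ^+ k * t <= - d.
Proof.
move=> d0 td; have h : 1 <= (1 - t) ^+ k by rewrite exprn_ege1 //; lra.
nra.
Qed.

(** Nonnegative G_i contribute at most lam m / (2 k) <= nu / 2 in total.  Where f may
    be as small as - A0, a single G_i <= - delta raises the value by at least
    lam delta, which makes up for the missing A0 + nu. *)
Lemma penalized_ge (m k : nat) (G : 'I_m -> R) (f nu A0 delta lam : R) :
  (forall i, `|G i| <= 1) -> 0 < nu -> 0 < delta -> 0 <= lam -> (0 < k)%N ->
  - A0 <= f -> nu <= f \/ (exists i, G i <= - delta) ->
  A0 + nu <= lam * delta -> lam * m%:R <= nu * k%:R ->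
  nu / 2 <= f - lam * \sum_i (1 - G i) ^+ k.*2 * G i.
Proof.
move=> hG nu0 d0 lam0 k0 fA hf hl hk.
have kR : 0 < k%:R :> R by rewrite ltr0n.
have ub i : (1 - G i) ^+ k.*2 * G i <= (2 * k%:R)^-1.
  rewrite -[leRHS]mul1r ler_pdivlMr ?mulr_gt0 // mulrC.
  by have := penalty_le k.*2 (hG i); rewrite -mul2n natrM.
have lub : lam * (m%:R / (2 * k%:R)) <= nu / 2.
  rewrite mulrA ler_pdivrMr ?mulr_gt0 //; apply: le_trans hk _.
  by rewrite le_eqVlt; apply/orP; left; apply/eqP; field.
have sub (P : pred 'I_m) :
    \sum_(i | P i) (1 - G i) ^+ k.*2 * G i <= m%:R / (2 * k%:R).
  apply: (@le_trans _ _ (\sum_(i < m) (2 * k%:R)^-1)); last first.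
    by rewrite sumr_const card_ord -[leLHS]mulr_natl.
  rewrite big_mkcond /=; apply: ler_sum => i _; case: ifP => _; first exact: ub.
  by rewrite invr_ge0 mulr_ge0 // ltW.
case: hf => [hf|[i hi]].
  have := ler_wpM2l lam0 (sub xpredT); lra.
rewrite (bigD1 i) //=.
have h1 := ler_wpM2l lam0 (sub (fun j => j != i)).
have h2 := ler_wpM2l lam0 (penalty_neg k.*2 (ltW d0) hi).
rewrite mulrDr; lra.
Qed.

End Penalty.

Section Certificate.
Variables (R : realType) (n m : nat) (g : m.-tuple {mpoly R[n]}).
Variables (r : R) (r_gt0 : 0 < r).
Implicit Types p q : {mpoly R[n]}.

(** Both the box certificate of the penalised polynomial and the penalty itself
    have degree controlled by the order 2 M of the Bernstein expansion.  The
    factor 4 ^ k bounds the coefficient sum of (1 - c g_i) ^ (2 k), that of c g_i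
    being at most 1. *)
Lemma truncated_penalized (E : nat) (c : R) (D : nat) (A A0 nu delta lam : R)
    (k M : nat) p :
  0 < c ->
  (forall i, box_expansion r E 1 (c *: tnth g i)) ->
  (forall I, truncated_quadratic_module g E%:R (box_product r I)) ->
  box_expansion r D A p -> 0 <= A ->
  0 < nu -> 0 < delta -> 0 <= lam -> (0 < k)%N -> (0 < M)%N ->
  (forall x, box r x -> - A0 <= p.@[x]) ->
  (forall x, box r x ->
     nu <= p.@[x] \/ exists i, (c *: tnth g i).@[x] <= - delta) ->
  A0 + nu <= lam * delta -> lam * m%:R <= nu * k%:R ->
  (D + (k.*2).+1 * E <= M.*2)%N ->
  (A + lam * m%:R * 4 ^+ k) * ((D + (k.*2).+1 * E) ^ 2)%:R <= nu * M%:R ->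
  truncated_quadratic_module g (2 * (n * M) + E + M.*2)%:R p.
Proof.
move=> c0 hg hI hp A_ge0 nu0 d0 lam0 k0 M0 pA hpg hl hk hD hA.
pose G i := c *: tnth g i.
pose D' := (D + (k.*2).+1 * E)%N.
pose s : {mpoly R[n]} := \sum_i (1 - G i) ^+ k.*2 * G i.
have hs1 i : box_expansion r ((k.*2).+1 * E) (4 ^+ k) ((1 - G i) ^+ k.*2 * G i).
  have h1 : box_expansion r E 2 (1 - G i).
    have -> : 1 - G i = 1%:MP + (-1) *: G i by rewrite scaleN1r mpolyC1.
    have -> : 2 = `|1| + `|-1| * 1 :> R by rewrite normrN normr1; ring.
    apply: box_expansionD; last exact: box_expansionZ (hg i).
    by apply: (box_expansionW (leq0n E) _ (box_expansionC n r 1)).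
  have -> : 4 ^+ k = 2 ^+ k.*2 * 1 :> R.
    by rewrite mulr1 -mul2n exprM; congr (_ ^+ _); ring.
  rewrite mulSn addnC; apply: box_expansionM.
  - by rewrite exprn_ge0.
  - exact: box_expansion_exp.
  - exact: hg.
have hs : box_expansion r D' (lam * m%:R * 4 ^+ k) (- lam *: s).
  have -> : lam * m%:R * 4 ^+ k = `|- lam| * \sum_(i < m) 4 ^+ k.
    by rewrite normrN ger0_norm // sumr_const card_ord -mulrA [m%:R * _]mulr_natl.
  apply: box_expansionW (box_expansionZ _ (box_expansion_sum _ hs1)) => //.
  by rewrite leq_addl.
have hh : box_expansion r D' (A + lam * m%:R * 4 ^+ k) (p + - lam *: s).
  by apply: box_expansionD => //; apply: box_expansionW hp; rewrite ?leq_addr.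
have hmu x : box r x -> nu / 2 <= (p + - lam *: s).@[x].
  move=> bx; rewrite mevalD mevalZ mulNr raddf_sum /=.
  under eq_bigr do rewrite mevalM rmorphXn rmorphB /= meval1.
  apply: (@penalized_ge _ m k (fun i => (G i).@[x]) _ nu A0 delta) => //.
  - by move=> i; exact: (box_expansion_bound r_gt0 (hg i) bx).
  - exact: pA.
  - exact: hpg.
have -> : p = (p + - lam *: s) + lam *: s by rewrite scaleNr subrK.
apply: truncatedD.
  apply: truncatedW (leq_addr _ _) _.
  apply: (truncated_box_positive r_gt0 hI hh hmu M0) => //.
  by apply: le_trans hA _; rewrite -mul2n natrM mulrA divfK.
apply: truncatedZ => //; apply: truncated_sum => i _.
have -> : (1 - G i) ^+ k.*2 * G i = (c *: ((1 - G i) ^+ k) ^+ 2) * tnth g i.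
  by rewrite -exprM muln2 -scalerAl -scalerAr.
apply: truncated_gen; first by apply: sosZ; [exact: ltW | exact: sos_sqr].
have -> : (c *: ((1 - G i) ^+ k) ^+ 2) * tnth g i = (1 - G i) ^+ k.*2 * G i.
  by rewrite -exprM muln2 -scalerAl -scalerAr.
have := box_expansion_tdeg (hs1 i); lia.
Qed.

End Certificate.

(** * Compactness of the box *)

Section Compactness.
Import numFieldNormedType.Exports.
Variables (R : realType) (n : nat).
Implicit Types p q : {mpoly R[n]}.

Lemma meval_continuous p : continuous (fun v : 'rV[R]_n => p.@[fun i => v ord0 i]).
Proof.
have cX (i : 'I_n) : continuous (fun v : 'rV[R]_n => v ord0 i).
  exact: coord_continuous.
have cM (F H : 'rV[R]_n -> R) : continuous F -> continuous H ->
    continuous (fun v => F v * H v).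
  by move=> cF cH v; exact: (continuousM (cF v) (cH v)).
have cD (F H : 'rV[R]_n -> R) : continuous F -> continuous H ->
    continuous (fun v => F v + H v).
  by move=> cF cH v; exact: (continuousD (cF v) (cH v)).
have cC (c : R) : continuous (fun v : 'rV[R]_n => c).
  exact: cst_continuous.
have cE (F H : 'rV[R]_n -> R) : F =1 H -> continuous F -> continuous H.
  by move=> /funext ->.
elim/mpolyind: p => [|c a p _ _ IH].
  by apply: (cE) (cC 0) => v; rewrite meval0.
apply: (cE (fun v => c * \prod_i v ord0 i ^+ a i + p.@[fun i => v ord0 i])).
  by move=> v; rewrite mevalD mevalZ mevalX.
apply: (cD) IH; apply: (cM); first exact: cC.
elim: (index_enum _) => [|i s IHs].
  by apply: (cE) (cC 1) => v; rewrite big_nil.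
apply: (cE (fun v => v ord0 i ^+ a i * \prod_(j <- s) v ord0 j ^+ a j)).
  by move=> v; rewrite big_cons.
apply: (cM) IHs; elim: (a i) => [|k IHk].
  by apply: (cE) (cC 1) => v; rewrite expr0.
apply: (cE (fun v => v ord0 i * v ord0 i ^+ k)); first by move=> v; rewrite exprS.
exact: cM (cX i) IHk.
Qed.

(** The sum of the positive parts of the - G_i is continuous and positive on a
    compact set, hence bounded below; one of the - G_i is then bounded below by a
    fixed fraction of that bound.  The set Q may be infinite: in the application
    it expresses that a point is far from every point of a set. *)
Lemma compact_separation (r : R) (Q : set {mpoly R[n]}) (I : finType)
    (G : I -> {mpoly R[n]}) :
  (forall x, box r x -> (forall q, Q q -> 0 <= q.@[x]) ->
     exists i, (G i).@[x] < 0) ->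
  exists2 eps, 0 < eps &
    forall x, box r x -> (forall q, Q q -> 0 <= q.@[x]) ->
      exists i, (G i).@[x] <= - eps.
Proof.
move=> hneg; pose pt (v : 'rV[R]_n) (i : 'I_n) := v ord0 i.
pose K := [set v : 'rV[R]_n | box r (pt v)] `&`
          \bigcap_(q in Q) [set v | 0 <= q.@[pt v]].
have [K0|/set0P Kn0] := eqVneq K set0.
  exists 1 => // x bx qx; suff : K (\row_i x i) by rewrite K0.
  split=> [i|q hq] /=.
    by rewrite /pt mxE; exact: bx.
  by rewrite (meval_eq (v2 := x)) => [|i]; [exact: qx | rewrite /pt mxE].
have Kc : compact K.
  apply: compact_closedI.
    rewrite (_ : [set v | _] = [set v : 'rV[R]_n | forall i, `[- r, r] (v ord0 i)]).
      by apply: (@rV_compact _ _ (fun=> `[- r, r])) => i; exact: segment_compact.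
    by apply/seteqP; split=> v /= h i; have := h i; rewrite in_itv.
  apply: closed_bigI => q _.
  apply: (@preimage_closed _ _ (fun v => q.@[pt v]) [set y : R | 0 <= y]).
    by move=> v _; exact: (@meval_continuous q v).
  exact: closed_ge.
pose Phi (v : 'rV[R]_n) := \sum_i Num.max 0 (- (G i).@[pt v]).
have cPhi : continuous Phi.
  rewrite /Phi; elim: (index_enum _) => [|i s IHs].
    rewrite (_ : (fun v => _) = (fun=> 0 : R)); last first.
      by apply/funext => v; rewrite big_nil.
    exact: cst_continuous.
  rewrite (_ : (fun v => _) =
     (fun v => Num.max 0 (- (G i).@[pt v]) + \sum_(j <- s) Num.max 0 (- (G j).@[pt v])));
    last by apply/funext => v; rewrite big_cons.
  move=> v; apply: (continuousD _ (IHs v)).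
  apply: (@continuous_max R _ (fun=> 0) (fun v => - (G i).@[pt v])).
    exact: cst_continuous.
  exact: (continuousN (@meval_continuous (G i) v)).
have [v Kv hmin] := EVT_min_rV Kn0 Kc (continuous_subspaceT cPhi).
have vK : K v by rewrite inE in Kv.
have max_ge0 (y : R) : 0 <= Num.max 0 y by rewrite le_max lexx.
have Phi0 : 0 < Phi v.
  have [i hi] := hneg (pt v) vK.1 vK.2.
  rewrite /Phi (bigD1 i) //=; apply: ltr_pwDl; last by apply: sumr_ge0.
  by rewrite lt_max oppr_gt0 hi orbT.
have I0 : 0 < (#|I|.+1)%:R :> R by rewrite ltr0n.
exists (Phi v / (#|I|.+1)%:R); first by rewrite divr_gt0.
move=> x bx qx; apply: contrapT => /forallNP hx.
have Kx : K (\row_i x i).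
  split=> [i|q hq] /=.
    by rewrite /pt mxE; exact: bx.
  by rewrite (meval_eq (v2 := x)) => [|i]; [exact: qx | rewrite /pt mxE].
have := hmin (\row_i x i); rewrite inE => /(_ Kx).
apply/negP; rewrite -ltNge.
apply: (@le_lt_trans _ _ (\sum_(i : I) (Phi v / (#|I|.+1)%:R))).
  apply: ler_sum => i _; rewrite ge_max divr_ge0 ?(ltW Phi0) ?(ltW I0) //=.
  rewrite (meval_eq (v2 := x)) => [|j]; last by rewrite /pt mxE.
  by have /negP := hx i; rewrite -ltNge lerNl => /ltW.
rewrite sumr_const -[ltLHS]mulr_natr -mulrA gtr_pMr //.
by rewrite mulrC ltr_pdivrMr // mul1r ltr_nat.
Qed.

End Compactness.

(** * Growth of semialgebraic functions of one variable *)

Section BivariateGrowth.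
Variable R : realType.
Implicit Types (P Q : {poly {poly R}}) (q u : {poly R}).

Lemma horner_bounded B q :
  exists2 C, 0 <= C & forall s, `|s| <= B -> `|q.[s]| <= C.
Proof.
elim/poly_ind: q => [|q c [C C0 hC]].
  by exists 0 => // s _; rewrite horner0 normr0.
exists (C * `|B| + `|c|); first by rewrite addr_ge0 // mulr_ge0.
move=> s sB; rewrite hornerD hornerMX hornerC.
apply: (le_trans (ler_normD _ _)); rewrite lerD2r normrM ler_pM ?hC //.
by apply: le_trans sB (ler_norm _).
Qed.

Lemma horner2_bounded B Q :
  exists2 C, 0 <= C &
    forall e s, 0 <= e <= 1 -> `|s| <= B -> `|Q.[e%:P].[s]| <= C.
Proof.
elim/poly_ind: Q => [|Q c [C C0 hC]].
  by exists 0 => // e s _ _; rewrite horner0 horner0 normr0.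
have [C' C'0 hC'] := horner_bounded B c.
exists (C + C'); first by rewrite addr_ge0.
move=> e s e01 sB; rewrite hornerD hornerMX hornerC hornerD hornerM hornerC.
apply: (le_trans (ler_normD _ _)); apply: lerD; last exact: hC'.
rewrite normrM; apply: (le_trans _ (hC _ _ e01 sB)).
by case/andP: e01 => e0 e1; rewrite ler_piMr // ger0_norm.
Qed.

(** Factor the largest power of e out of Q(e, s), and then the largest power of s
    out of the value at e = 0 of the quotient: what remains is
    q(s) s ^ k + e Q2(e, s), with Q2 bounded. *)
Lemma bivariate_root_bound Q B : Q != 0 ->
  exists k C q, [/\ 0 <= C, ~~ root q 0 &
    forall e s, 0 < e <= 1 -> `|s| <= B -> Q.[e%:P].[s] = 0 ->
      `|q.[s] * s ^+ k| <= C * e].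
Proof.
move=> Q0; have [a [Q1 hQ1 eQ]] := multiplicity_XsubC Q 0.
have q0 : Q1.[0] != 0 by move: hQ1; rewrite Q0.
have [k [u hu eu]] := multiplicity_XsubC Q1.[0] 0.
have : root (Q1 - Q1.[0]%:P) 0 by rewrite /root hornerD hornerN hornerC subrr.
case/factor_theorem => Q2 eQ2.
have [C C0 hC] := horner2_bounded B Q2.
exists k, C, u; split=> //; first by move: hu; rewrite q0.
move=> e s e01 sB Qes; have e0 : 0 < e by case/andP: e01.
have Q1es : Q1.[e%:P].[s] = 0.
  move: Qes; rewrite eQ hornerM horner_exp hornerXsubC subr0 hornerM horner_exp.
  by rewrite hornerC => /eqP; rewrite mulf_eq0 expf_eq0 (gt_eqF e0) andbF orbF => /eqP.
have : (Q1 - Q1.[0]%:P).[e%:P].[s] = Q2.[e%:P].[s] * e.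
  by rewrite eQ2 hornerM hornerXsubC subr0 hornerM hornerC.
rewrite hornerD hornerN hornerC hornerD hornerN Q1es sub0r.
have -> : Q1.[0].[s] = u.[s] * s ^+ k.
  by rewrite eu hornerM horner_exp hornerXsubC subr0.
move=> /(congr1 Num.norm); rewrite normrN => ->.
rewrite normrM (gtr0_norm e0) ler_wpM2r ?(ltW e0) // hC //.
by rewrite (ltW e0); case/andP: e01.
Qed.

(** The hypothesis on Q says that, for fixed e, the set of the s with A e s can only
    have boundary points at roots of Q(e, .).  So its supremum f(e) is a root, and
    [bivariate_root_bound] applies to it; the factor q(f(e)) stays away from 0 for
    small e because f(e) tends to 0.  For the other e, boundedness of f is
    enough. *)
Lemma semialgebraic_growth (A : R -> R -> Prop) Q (B : R) : Q != 0 ->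
  (forall e s, Q.[e%:P].[s] != 0 -> exists2 eta, 0 < eta &
      forall s', `|s' - s| < eta -> (A e s' <-> A e s)) ->
  (forall e, 0 < e -> A e 0) ->
  (forall e s, A e s -> s <= B) ->
  (forall eta, 0 < eta -> exists2 e0, 0 < e0 &
      forall e s, 0 < e <= e0 -> A e s -> s <= eta) ->
  exists k, exists2 C, 0 < C &
    forall e s, 0 < e <= 1 -> 0 <= s -> A e s -> s ^+ k <= C * e.
Proof.
move=> Q0 hQ hA0 hB hlim.
pose f e := sup [set s | A e s].
have fs e : 0 < e -> has_sup [set s | A e s].
  by move=> e0; split; [exists 0; exact: hA0 | exists B => s; exact: hB].
have f_ub e s : 0 < e -> A e s -> s <= f e.
  by move=> e0 As; apply: sup_ubound => //; exact: (fs e e0).2.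
have f_ge0 e : 0 < e -> 0 <= f e by move=> e0; apply: f_ub => //; exact: hA0.
have f_le e c : 0 < e -> (forall s, A e s -> s <= c) -> f e <= c.
  by move=> e0 h; apply: sup_le_ub => //; exists 0; exact: hA0.
have f_root e : 0 < e -> Q.[e%:P].[f e] = 0.
  move=> e0; apply/eqP/contraT => /hQ[eta eta0 heta].
  have [Af|nAf] := pselect (A e (f e)).
    have : A e (f e + eta / 2).
      by apply/heta => //; rewrite addrC addKr ger0_norm; lra.
    by move/(f_ub _ _ e0); lra.
  have [s As hs] := sup_adherent eta0 (fs e e0); case: nAf.
  apply/(heta s) => //; have := f_ub _ _ e0 As; rewrite -/(f e) in hs.
  by move=> h; rewrite ler0_norm; lra.
have [k [C [u [C0 u0 hC]]]] := bivariate_root_bound B Q0.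
have fB e : 0 < e -> `|f e| <= B.
  by move=> e0; rewrite ger0_norm ?f_ge0 // f_le // => s; exact: hB.
have B0 : 0 <= B by apply: le_trans (fB 1 ltr01).
have un0 : 0 < `|u.[0]| by rewrite normr_gt0.
have un2 : 0 < `|u.[0]| / 2 by lra.
have [eta eta0 heta] := polyrcf.poly_cont 0 u un2.
have eta2 : 0 < eta / 2 by lra.
have [e0 e0_gt0 he0] := hlim _ eta2.
exists k; exists (C * 2 / `|u.[0]| + B ^+ k / e0 + 1).
  by rewrite ltr_wpDl // addr_ge0 // divr_ge0 ?mulr_ge0 ?exprn_ge0 // ltW.
move=> e s e01 s0 As; have ep : 0 < e by case/andP: e01.
have sf : s ^+ k <= f e ^+ k by rewrite lerXn2r ?nnegrE ?f_ge0 // f_ub.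
apply: (le_trans sf); rewrite !mulrDl mul1r.
have t1 : 0 <= C * 2 / `|u.[0]| * e.
  by rewrite mulr_ge0 ?(ltW ep) // divr_ge0 // mulr_ge0.
have t2 : 0 <= B ^+ k / e0 * e.
  by rewrite mulr_ge0 ?(ltW ep) // divr_ge0 ?exprn_ge0 // ltW.
have [ee0|ee0] := leP e e0.
  have fe : f e <= eta / 2 by apply: f_le => // s'; apply: he0; rewrite ep.
  have uf : `|u.[0]| / 2 <= `|u.[f e]|.
    have h : `|f e - 0| < eta.
      by rewrite subr0 ger0_norm ?f_ge0 //; lra.
    have := heta _ h; rewrite distrC => h'.
    by have := lerB_dist u.[0] u.[f e]; lra.
  have := hC _ _ e01 (fB _ ep) (f_root _ ep).
  rewrite normrM (ger0_norm (exprn_ge0 k (f_ge0 _ ep))) => h.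
  have h2 : `|u.[0]| / 2 * f e ^+ k <= C * e.
    by apply: le_trans h; rewrite ler_wpM2r // exprn_ge0 // f_ge0.
  have h3 : f e ^+ k <= C * 2 / `|u.[0]| * e.
    have -> : C * 2 / `|u.[0]| * e = C * e / (`|u.[0]| / 2).
      by field; rewrite gt_eqF.
    by rewrite ler_pdivlMr // mulrC.
  lra.
have h3 : f e ^+ k <= B ^+ k / e0 * e.
  apply: (@le_trans _ _ (B ^+ k)).
    rewrite lerXn2r ?nnegrE ?f_ge0 //.
    by have := fB _ ep; rewrite ger0_norm ?f_ge0.
  by rewrite -mulrA ler_peMr ?exprn_ge0 // mulrC ler_pdivlMr // mul1r ltW.
lra.
Qed.

End BivariateGrowth.

(** * Definable sets and quantifier elimination *)

Section Definable.
Variable R : realType.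

Local Notation formula := (ordered_qelim.ord.formula R).
Local Notation holds := (@ordered_qelim.ord.holds R).
Local Notation qf_eval := (@ordered_qelim.ord.qf_eval R).
Local Notation qf_form := (@ordered_qelim.ord.qf_form R).
Local Notation rformula := (@ordered_qelim.ord.rformula R).

(** Environments are lists, and definability is asserted for lists of a given
    length N only: a quantifier over the variable number N then appends its value
    to the list, so that blocks of quantifiers append blocks of coordinates. *)
Definition term_function (F : seq R -> R) :=
  exists t : GRing.term R, forall e, GRing.eval e t = F e.

Lemma term_function_var i : term_function (fun e => e`_i).
Proof. by exists (GRing.Var R i). Qed.

Lemma term_function_const c : term_function (fun=> c).
Proof. by exists (GRing.Const c). Qed.

Lemma term_functionD F G : term_function F -> term_function G ->
  term_function (fun e => F e + G e).
Proof. by move=> [t ht] [u hu]; exists (GRing.Add t u) => e /=; rewrite ht hu. Qed.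

Lemma term_functionN F : term_function F -> term_function (fun e => - F e).
Proof. by move=> [t ht]; exists (GRing.Opp t) => e /=; rewrite ht. Qed.

Lemma term_functionM F G : term_function F -> term_function G ->
  term_function (fun e => F e * G e).
Proof. by move=> [t ht] [u hu]; exists (GRing.Mul t u) => e /=; rewrite ht hu. Qed.

Lemma term_functionX F k : term_function F -> term_function (fun e => F e ^+ k).
Proof. by move=> [t ht]; exists (GRing.Exp t k) => e /=; rewrite ht. Qed.

Lemma term_function_sum I (s : seq I) (F : I -> seq R -> R) :
  (forall i, term_function (F i)) -> term_function (fun e => \sum_(i <- s) F i e).
Proof.
move=> hF; elim: s => [|i s [t ht]].
  by exists (GRing.Const 0) => e; rewrite big_nil.
have [u hu] := hF i; exists (GRing.Add u t) => e.
by rewrite big_cons /= hu ht.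
Qed.

Lemma term_function_prod I (s : seq I) (F : I -> seq R -> R) :
  (forall i, term_function (F i)) -> term_function (fun e => \prod_(i <- s) F i e).
Proof.
move=> hF; elim: s => [|i s [t ht]].
  by exists (GRing.Const 1) => e; rewrite big_nil.
have [u hu] := hF i; exists (GRing.Mul u t) => e.
by rewrite big_cons /= hu ht.
Qed.

Lemma term_function_meval n (p : {mpoly R[n]}) (k : nat) :
  term_function (fun e => p.@[fun i => e`_(k + i)]).
Proof.
have [t ht] : term_function (fun e =>
    \sum_(a <- msupp p) p@_a * \prod_(i < n) e`_(k + i) ^+ a i).
  apply: term_function_sum => a; apply: term_functionM.
    exact: term_function_const.
  apply: term_function_prod => i; apply: term_functionX; exact: term_function_var.
by exists t => e; rewrite ht mevalE.
Qed.

Definition definable (N : nat) (P : seq R -> Prop) :=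
  exists f : formula, forall e, size e = N -> (holds e f <-> P e).

Lemma definable_ext N P P' : (forall e, size e = N -> (P e <-> P' e)) ->
  definable N P -> definable N P'.
Proof. by move=> h [f hf]; exists f => e eN; rewrite hf // h. Qed.

Lemma definable_le N F G : term_function F -> term_function G ->
  definable N (fun e => F e <= G e).
Proof.
move=> [t ht] [u hu]; exists (ordered_qelim.ord.Le t u) => e _ /=.
by rewrite ht hu.
Qed.

Lemma definable_and N P P' : definable N P -> definable N P' ->
  definable N (fun e => P e /\ P' e).
Proof.
move=> [f hf] [f' hf']; exists (ordered_qelim.ord.And f f') => e eN /=.
by rewrite hf // hf'.
Qed.

Lemma definable_imp N P P' : definable N P -> definable N P' ->
  definable N (fun e => P e -> P' e).
Proof.
move=> [f hf] [f' hf']; exists (ordered_qelim.ord.Implies f f') => e eN /=.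
by rewrite hf // hf'.
Qed.

Lemma definable_forall_fin (I : finType) N (P : I -> seq R -> Prop) :
  (forall i, definable N (P i)) -> definable N (fun e => forall i, P i e).
Proof.
move=> hP; suff h (s : seq I) : definable N (fun e => forall i, i \in s -> P i e).
  by apply: definable_ext (h (enum I)) => e _; split=> h' i; [apply: h'; rewrite mem_enum|].
elim: s => [|i s IH].
  by exists (ordered_qelim.ord.Bool true) => e _; split.
apply: definable_ext (definable_and (hP i) IH) => e _; split.
  by move=> [h1 h2] j; rewrite inE => /orP[/eqP->|/h2].
by move=> h; split=> [|j js]; apply: h; rewrite inE ?eqxx ?js ?orbT.
Qed.

Lemma set_nth_rcons (e : seq R) (x : R) : set_nth 0 e (size e) x = rcons e x.
Proof. by elim: e => //= y e ->. Qed.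

Lemma definable_exists n N P : definable (N + n) P ->
  definable N (fun e => exists2 s, size s = n & P (e ++ s)).
Proof.
elim: n N => [|n IH] N.
  rewrite addn0; apply: definable_ext => e _; split=> [h|[s /size0nil ->]].
    by exists [::]; rewrite ?cats0.
  by rewrite cats0.
rewrite addnS -addSn => /IH[f hf]; exists (ordered_qelim.ord.Exists N f) => e eN /=.
split=> [[x]|[s]].
  rewrite -eN set_nth_rcons => /hf; rewrite size_rcons eN => /(_ erefl)[s sn hs].
  by exists (x :: s); [rewrite /= sn | rewrite -cat_rcons].
case: s => // x s [sn] hs; exists x; rewrite -eN set_nth_rcons.
by apply/hf; [rewrite size_rcons eN | exists s; rewrite // cat_rcons].
Qed.

Lemma definable_forall n N P : definable (N + n) P ->
  definable N (fun e => forall s, size s = n -> P (e ++ s)).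
Proof.
elim: n N => [|n IH] N.
  rewrite addn0; apply: definable_ext => e _; split=> [h s /size0nil ->|].
    by rewrite cats0.
  by move=> /(_ [::] erefl); rewrite cats0.
rewrite addnS -addSn => /IH[f hf]; exists (ordered_qelim.ord.Forall N f) => e eN /=.
split=> [h s|h x].
  case: s => // x s [sn]; have := h x; rewrite -eN set_nth_rcons => /hf.
  by rewrite size_rcons eN => /(_ erefl s sn); rewrite cat_rcons.
rewrite -eN set_nth_rcons; apply/hf; first by rewrite size_rcons eN.
by move=> s sn; rewrite cat_rcons; apply: h; rewrite /= sn.
Qed.

Lemma definable_quantifier_free N P : definable N P ->
  exists f : formula, [/\ qf_form f, rformula f &
    forall e, size e = N -> (qf_eval e f <-> P e)].
Proof.
move=> [f hf].
pose proj i bc := qe_rcf.qfr_to_formula (@qe_rcf.wproj R i bc).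
pose f' := ordered_qelim.ord.quantifier_elim proj
             (ordered_qelim.ord.to_rform f).
have rf := ordered_qelim.ord.to_rform_rformula f.
have /andP[qf' rf'] := ordered_qelim.ord.quantifier_elim_wf
  (wproj := proj) (@qe_rcf.wf_QE_wproj R) rf.
exists f'; split=> // e eN; rewrite -hf //.
have h := ordered_qelim.ord.quantifier_elim_rformP
  (wproj := proj) (@qe_rcf.wf_QE_wproj R) (@qe_rcf.valid_QE_wproj R) e rf.
split=> [/h|]; first by move/ordered_qelim.ord.to_rformP.
by move=> hh; apply/h; apply/ordered_qelim.ord.to_rformP.
Qed.

Lemma term_bivariate (t : GRing.term R) : GRing.rterm t ->
  exists P : {poly {poly R}}, forall e s, GRing.eval [:: e; s] t = P.[e%:P].[s].
Proof.
elim: t => //=.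
- case=> [|[|k]] _.
  + by exists 'X => e s; rewrite hornerX hornerC.
  + by exists ('X%:P) => e s; rewrite hornerC hornerX.
  + by exists 0 => e s; rewrite /= nth_nil horner0 horner0.
- by move=> c _; exists (c%:P%:P) => e s; rewrite hornerC hornerC.
- by move=> k _; exists (k%:R) => e s; rewrite -!polyC_natr !hornerC.
- move=> t IHt u IHu /andP[/IHt[P hP] /IHu[Q hQ]]; exists (P + Q) => e s.
  by rewrite hP hQ !hornerD.
- by move=> t IHt /IHt[P hP]; exists (- P) => e s; rewrite hP !hornerN.
- by move=> t IHt k /IHt[P hP]; exists (P *+ k) => e s; rewrite hP !hornerMn.
- move=> t IHt u IHu /andP[/IHt[P hP] /IHu[Q hQ]]; exists (P * Q) => e s.
  by rewrite hP hQ !hornerM.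
- by move=> t IHt k /IHt[P hP]; exists (P ^+ k) => e s; rewrite hP !horner_exp.
Qed.

Lemma sgr_locally_constant (q : {poly R}) (s : R) : q.[s] != 0 ->
  exists2 eta, 0 < eta &
    forall s', `|s' - s| < eta -> Num.sg q.[s'] = Num.sg q.[s].
Proof.
move=> qs; have h : 0 < `|q.[s]| by rewrite normr_gt0.
have [eta eta0 heta] := polyrcf.poly_cont s q h.
exists eta => // s' /heta; have [q0|q0|/eqP] := ltrgtP 0 q.[s]; last first.
- by rewrite eq_sym (negPf qs).
- rewrite (ltr0_norm q0) ltr_norml => /andP[h1 h2].
  by rewrite !ltr0_sg //; lra.
- rewrite (gtr0_norm q0) ltr_norml => /andP[h1 h2].
  by rewrite !gtr0_sg //; lra.
Qed.

(** If P = 0 its sign is constant and Q = 1 works, otherwise Q = P does. *)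
Lemma bivariate_sgr (P : {poly {poly R}}) :
  exists2 Q : {poly {poly R}}, Q != 0 & forall e s, Q.[e%:P].[s] != 0 ->
    exists2 eta, 0 < eta & forall s', `|s' - s| < eta ->
      Num.sg P.[e%:P].[s'] = Num.sg P.[e%:P].[s].
Proof.
have [->|P0] := eqVneq P 0.
  exists 1; first exact: oner_neq0.
  by move=> e s _; exists 1 => // s' _; rewrite horner0 !horner0.
by exists P => // e s; exact: sgr_locally_constant.
Qed.

(** The truth value of an atom can change only at roots of the polynomial that it
    compares with 0; for connectives, multiply the polynomials. *)
Lemma qf_eval_locally_constant (f : formula) : qf_form f -> rformula f ->
  exists2 Q : {poly {poly R}}, Q != 0 & forall e s, Q.[e%:P].[s] != 0 ->
    exists2 eta, 0 < eta & forall s', `|s' - s| < eta ->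
      qf_eval [:: e; s'] f = qf_eval [:: e; s] f.
Proof.
have atom (t u : GRing.term R) : GRing.rterm t && GRing.rterm u ->
    exists2 Q : {poly {poly R}}, Q != 0 & forall e s, Q.[e%:P].[s] != 0 ->
    exists2 eta, 0 < eta & forall s', `|s' - s| < eta ->
      Num.sg (GRing.eval [:: e; s'] t - GRing.eval [:: e; s'] u) =
      Num.sg (GRing.eval [:: e; s] t - GRing.eval [:: e; s] u).
  move=> /andP[/term_bivariate[P hP] /term_bivariate[P' hP']].
  have [Q Q0 hQ] := bivariate_sgr (P - P'); exists Q => // e s /hQ[eta eta0 h].
  exists eta => // s' /h; rewrite !hornerD !hornerN.
  by rewrite !hP !hP'.
have conn (f1 f2 : formula) (op : bool -> bool -> bool) :
    (exists2 Q : {poly {poly R}}, Q != 0 & forall e s, Q.[e%:P].[s] != 0 ->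
      exists2 eta, 0 < eta & forall s', `|s' - s| < eta ->
      qf_eval [:: e; s'] f1 = qf_eval [:: e; s] f1) ->
    (exists2 Q : {poly {poly R}}, Q != 0 & forall e s, Q.[e%:P].[s] != 0 ->
      exists2 eta, 0 < eta & forall s', `|s' - s| < eta ->
      qf_eval [:: e; s'] f2 = qf_eval [:: e; s] f2) ->
    exists2 Q : {poly {poly R}}, Q != 0 & forall e s, Q.[e%:P].[s] != 0 ->
      exists2 eta, 0 < eta & forall s', `|s' - s| < eta ->
      op (qf_eval [:: e; s'] f1) (qf_eval [:: e; s'] f2) =
      op (qf_eval [:: e; s] f1) (qf_eval [:: e; s] f2).
  move=> [Q1 Q10 h1] [Q2 Q20 h2]; exists (Q1 * Q2); first by rewrite mulf_neq0.
  move=> e s; rewrite !hornerM mulf_eq0 negb_or => /andP[/h1[a a0 ha] /h2[b b0 hb]].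
  exists (Num.min a b); first by rewrite lt_min a0.
  by move=> s'; rewrite lt_min => /andP[/ha -> /hb ->].
elim: f => //=.
- by move=> b _ _; exists 1; [exact: oner_neq0 | move=> *; exists 1].
- move=> t u _ /atom[Q Q0 hQ]; exists Q => // e s /hQ[eta eta0 h].
  by exists eta => // s' /h hs; rewrite -subr_eq0 -sgr_eq0 hs sgr_eq0 subr_eq0.
- move=> t u _ /atom[Q Q0 hQ]; exists Q => // e s /hQ[eta eta0 h].
  by exists eta => // s' /h hs; rewrite -subr_lt0 -sgr_lt0 hs sgr_lt0 subr_lt0.
- move=> t u _ /atom[Q Q0 hQ]; exists Q => // e s /hQ[eta eta0 h].
  by exists eta => // s' /h hs; rewrite -subr_le0 -sgr_le0 hs sgr_le0 subr_le0.
- move=> f1 IH1 f2 IH2 /andP[q1 q2] /andP[r1 r2].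
  exact: (conn f1 f2 andb (IH1 q1 r1) (IH2 q2 r2)).
- move=> f1 IH1 f2 IH2 /andP[q1 q2] /andP[r1 r2].
  exact: (conn f1 f2 orb (IH1 q1 r1) (IH2 q2 r2)).
- move=> f1 IH1 f2 IH2 /andP[q1 q2] /andP[r1 r2].
  exact: (conn f1 f2 implb (IH1 q1 r1) (IH2 q2 r2)).
- move=> f1 IH1 q1 r1.
  exact: (conn f1 f1 (fun b _ => ~~ b) (IH1 q1 r1) (IH1 q1 r1)).
Qed.

Lemma definable_locally_constant P : definable 2 P ->
  exists2 Q : {poly {poly R}}, Q != 0 & forall e s, Q.[e%:P].[s] != 0 ->
    exists2 eta, 0 < eta & forall s', `|s' - s| < eta ->
      (P [:: e; s'] <-> P [:: e; s]).
Proof.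
move=> /definable_quantifier_free[f [qf rf hf]].
have [Q Q0 hQ] := qf_eval_locally_constant qf rf.
exists Q => // e s /hQ[eta eta0 h]; exists eta => // s' /h hs.
by rewrite -!hf // hs.
Qed.

End Definable.

(** * Lojasiewicz inequality *)

Section Lojasiewicz.
Variables (R : realType) (n m : nat) (g : m.-tuple {mpoly R[n]}).

Definition sqdist (x y : 'I_n -> R) : R := \sum_j (x j - y j) ^+ 2.

Lemma sqdist_ge0 x y : 0 <= sqdist x y.
Proof. by apply: sumr_ge0 => j _; exact: sqr_ge0. Qed.

Definition far_almost_feasible (e s : R) : Prop :=
  exists x, [/\ box 1 x, forall i, - e <= (tnth g i).@[x] &
    forall y, basic_set g y -> s <= sqdist x y].

(** In the environment the two parameters come first, followed by the coordinates
    of x and then by those of y. *)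
Lemma definable_far_almost_feasible :
  definable 2 (fun e => far_almost_feasible e`_0 e`_1).
Proof.
pose pt k (e : seq R) := fun i : 'I_n => e`_(k + i).
pose P2 e := (forall i, 0 <= (tnth g i).@[pt (2 + n)%N e]) ->
  e`_1 <= sqdist (pt 2%N e) (pt (2 + n)%N e).
pose P1 e := ((forall i, -1 <= pt 2%N e i) /\ (forall i, pt 2%N e i <= 1)) /\
  ((forall i, - e`_0 <= (tnth g i).@[pt 2%N e]) /\
   (forall s, size s = n -> P2 (e ++ s))).
have d2 : definable (2 + n + n) P2.
  apply: definable_imp.
    apply: definable_forall_fin => i; apply: definable_le.
      exact: term_function_const.
    exact: term_function_meval.
  apply: definable_le; first exact: term_function_var.
  apply: term_function_sum => j; apply: term_functionX; apply: term_functionD.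
    exact: term_function_var.
  by apply: term_functionN; exact: term_function_var.
have d1 : definable (2 + n) P1.
  apply: definable_and.
    apply: definable_and; apply: definable_forall_fin => i.
      by apply: definable_le; [exact: term_function_const | exact: term_function_var].
    by apply: definable_le; [exact: term_function_var | exact: term_function_const].
  apply: definable_and; last exact: definable_forall.
  apply: definable_forall_fin => i; apply: definable_le.
    by apply: term_functionN; exact: term_function_var.
  exact: term_function_meval.
apply: definable_ext (definable_exists d1) => e e2.
have ptE s (x : 'I_n -> R) : size s = 2%N ->
    pt 2%N (s ++ [seq x i | i <- enum 'I_n]) =1 x.
  move=> s2 i; rewrite /pt nth_cat s2 ltnNge leq_addr /= addKn.
  by rewrite (nth_map i) ?size_enum_ord // nth_ord_enum.
have pt2E s t : size s = (2 + n)%N -> pt 2%N (s ++ t) =1 pt 2%N s.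
  by move=> sn i; rewrite /pt nth_cat sn ltn_add2l ltn_ord.
have ptnE s (y : 'I_n -> R) : size s = (2 + n)%N ->
    pt (2 + n)%N (s ++ [seq y i | i <- enum 'I_n]) =1 y.
  move=> sn i; rewrite /pt nth_cat sn ltnNge leq_addr /= addKn.
  by rewrite (nth_map i) ?size_enum_ord // nth_ord_enum.
have n0 s : (e ++ s)`_0 = e`_0 by rewrite nth_cat e2.
have n1 s : (e ++ s)`_1 = e`_1 by rewrite nth_cat e2.
have dE x x' y y' : x =1 x' -> y =1 y' -> sqdist x y = sqdist x' y'.
  by move=> hx hy; apply: eq_bigr => j _; rewrite hx hy.
split.
  move=> [s sn [[h1 h2] [h3 h4]]]; exists (pt 2%N (e ++ s)).
  have esn : size (e ++ s) = (2 + n)%N by rewrite size_cat e2 sn.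
  split; first by move=> i; rewrite h1 h2.
    by move=> i; have := h3 i; rewrite n0.
  move=> y Sy; pose t := [seq y i | i <- enum 'I_n].
  have := h4 t; rewrite size_map size_enum_ord => /(_ erefl).
  rewrite /P2 -catA n1 catA (dE _ _ _ _ (pt2E _ t esn) (ptnE _ y esn)); apply.
  by move=> i; rewrite (meval_eq _ (ptnE _ y esn)); exact: (Sy i).
move=> [x [bx gx hx]]; exists [seq x i | i <- enum 'I_n].
  by rewrite size_map size_enum_ord.
have esn : size (e ++ [seq x i | i <- enum 'I_n]) = (2 + n)%N.
  by rewrite size_cat e2 size_map size_enum_ord.
split; first by split=> i; rewrite ptE //; case/andP: (bx i).
split; first by move=> i; rewrite n0 (meval_eq _ (ptE _ x e2)).
move=> t tn; rewrite /P2 -catA n1 catA => Sy.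
rewrite (dE _ x _ (pt (2 + n)%N ((e ++ [seq x i | i <- enum 'I_n]) ++ t))) //.
  by apply: hx => i; exact: (Sy i).
by move=> i; rewrite pt2E // ptE.
Qed.

(** The inequality is stated in contrapositive form: a point of the unit box at
    squared distance at least s from the basic set violates some constraint by
    more than e whenever C e < s ^ k. *)
Lemma lojasiewicz : basic_set g !=set0 -> basic_set g `<=` box 1 ->
  exists k, exists2 C, 0 < C & forall x e s, box 1 x -> 0 < e <= 1 -> 0 <= s ->
    (forall i, - e <= (tnth g i).@[x]) ->
    (forall y, basic_set g y -> s <= sqdist x y) -> s ^+ k <= C * e.
Proof.
move=> [y0 Sy0] Sbox.
have [Q Q0 hQ] := definable_locally_constant definable_far_almost_feasible.
have hA0 e : 0 < e -> far_almost_feasible e 0.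
  move=> e0; exists y0; split; first exact: Sbox.
    by move=> i; apply: (le_trans _ (Sy0 i)); rewrite oppr_le0 ltW.
  by move=> y _; exact: sqdist_ge0.
have hB e s : far_almost_feasible e s -> s <= \sum_(j < n) 4.
  move=> [x [bx _ hx]]; apply: (le_trans (hx y0 Sy0)); apply: ler_sum => j _.
  have /andP[h1 h2] := bx j; have /andP[h3 h4] := Sbox y0 Sy0 j.
  have -> : 4 = 2 ^+ 2 :> R by ring.
  by rewrite -ler_sqrt ?sqrtr_sqr ?exprn_gt0 // (ger0_norm (ler0n _ 2)) ler_norml; lra.
have hlim eta : 0 < eta -> exists2 e0, 0 < e0 &
    forall e s, 0 < e <= e0 -> far_almost_feasible e s -> s <= eta.
  move=> eta0.
  pose q (y : 'I_n -> R) : {mpoly R[n]} :=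
    \sum_j ('X_j - (y j)%:MP) ^+ 2 - eta%:MP.
  have qE y x : (q y).@[x] = sqdist x y - eta.
    rewrite mevalB mevalC raddf_sum; congr (_ - _); apply: eq_bigr => j _ /=.
    by rewrite rmorphXn /= mevalB mevalXU mevalC.
  have [x bx hx|e0 e0_gt0 he0] := @compact_separation R n 1
    [set p | exists2 y, basic_set g y & p = q y] _ (tnth g).
    apply: contrapT => /forallNP hg.
    have Sx : basic_set g x by move=> i; have /negP := hg i; rewrite -leNgt.
    have := hx (q x) (ex_intro2 _ _ x Sx erefl); rewrite qE.
    rewrite (_ : sqdist x x = 0); first lra.
    by apply: big1 => j _; rewrite subrr expr0n.
  exists (e0 / 2); first by rewrite divr_gt0.
  move=> e s /andP[ep ee0] [x [bx gx hx]]; rewrite leNgt; apply/negP => es.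
  have [p [y Sy ->]|i hi] := he0 x bx.
    by rewrite qE; have := hx y Sy; lra.
  by have := gx i; lra.
have [k [C C0 h]] := semialgebraic_growth Q0 hQ hA0 hB hlim.
exists k, C => // x e s bx e01 s0 gx hx; apply: h => //.
by exists x; split.
Qed.

End Lojasiewicz.

(** * Boxes in an archimedean quadratic module *)

Section Archimedean.
Variables (R : realType) (n m : nat) (g : m.-tuple {mpoly R[n]}).
Implicit Types p q : {mpoly R[n]}.

Local Notation TM k := (truncated_quadratic_module g k%:R).
Local Notation SOS := (@sums_of_squares R n).

Lemma truncated_uniform (I : finType) (F : I -> {mpoly R[n]}) :
  (forall i, exists k, TM k (F i)) -> exists E, forall i, TM E (F i).
Proof.
move=> /boolp.choice[k hk]; exists (\max_i k i)%N => i.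
by apply: truncatedW (hk i); exact: (leq_bigmax (F := k)).
Qed.

(** The coefficient sum being multiplied by c, it suffices to divide by a number
    that exceeds the coefficient sums of all the constraints. *)
Lemma scaled_constraints (r : R) : 0 < r ->
  exists2 c : R, 0 < c & exists E, forall i, box_expansion r E 1 (c *: tnth g i).
Proof.
move=> r0; pose B := 1 + 3 * r.
have B1 : 1 <= B by rewrite lerDl mulr_ge0 // ltW.
have rB : 3 * r <= B by rewrite lerDr.
pose A i := B ^+ tdeg (tnth g i) * coef_norm (tnth g i).
have A0 i : 0 <= A i by rewrite mulr_ge0 ?coef_norm_ge0 // exprn_ge0 // (le_trans _ B1).
have s0 : 0 <= \sum_i A i by apply: sumr_ge0.
exists (1 + \sum_i A i)^-1; first by rewrite invr_gt0; lra.
exists (\max_i tdeg (tnth g i))%N => i.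
apply: box_expansionW (box_expansionZ _ (box_expansion_mpoly r0 _ B1 rB)).
  exact: (leq_bigmax (F := fun i => tdeg (tnth g i))).
rewrite ger0_norm ?invr_ge0; last by lra.
rewrite mulrC ler_pdivrMr ?mul1r; last by lra.
by rewrite (bigD1 i) //= -/(A i) addrCA lerDl addr_ge0 // sumr_ge0.
Qed.

Lemma nat_above (x : R) : 0 <= x ->
  exists k : nat, [/\ (0 < k)%N, x <= k%:R & k%:R <= x + 1].
Proof.
move=> x0; have /andP[h1 h2] := truncn_itv x0.
exists (Num.truncn x).+1; split=> //; first exact: ltW.
by rewrite -natr1 lerD2r.
Qed.

(** By compactness there is eps > 0 such that at every point of the box p >= eps or
    some scaled constraint is at most - eps.  This is what the penalisation
    needs. *)
Lemma putinar_of_box (r : R) E p : 0 < r ->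
  (forall I, TM E (box_product r I)) ->
  (forall x, box r x -> basic_set g x -> 0 < p.@[x]) -> exists k, TM k p.
Proof.
move=> r0 hI hp.
have [c c0 [E' hg]] := scaled_constraints r0.
(* None stands for the constraint p <= 0, incompatible with those of g. *)
pose G (o : option 'I_m) := if o is Some i then c *: tnth g i else - p.
have [x bx _|eps eps0 heps] := @compact_separation R n r set0 _ G.
  have [Sx|nSx] := pselect (basic_set g x).
    by exists None; rewrite /= mevalN oppr_lt0 hp.
  have [i hi] : exists i, (tnth g i).@[x] < 0.
    apply: contrapT => /forallNP h; apply: nSx => i.
    by have /negP := h i; rewrite -leNgt.
  by exists (Some i); rewrite /= mevalZ pmulr_rlt0.
pose B := 1 + 3 * r.
have B1 : 1 <= B by rewrite lerDl mulr_ge0 // ltW.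
have rB : 3 * r <= B by rewrite lerDr.
have hexp := box_expansion_mpoly r0 p B1 rB.
set A := B ^+ _ * _ in hexp.
have A0 : 0 <= A by rewrite mulr_ge0 ?coef_norm_ge0 // exprn_ge0 // (le_trans _ B1).
pose lam := (A + eps) / eps.
have lam0 : 0 <= lam by rewrite divr_ge0 // ?addr_ge0 ?(ltW eps0).
have [k [k0 hk _]] := nat_above (x := lam * m%:R / eps)
   (divr_ge0 (mulr_ge0 lam0 (ler0n _ m)) (ltW eps0)).
pose E2 := maxn E E'.
pose D' := (tdeg p + (k.*2).+1 * E2)%N.
pose A' := A + lam * m%:R * 4 ^+ k.
have A'0 : 0 <= A'.
  by apply: (addr_ge0 A0); apply: mulr_ge0; [exact: mulr_ge0 | exact: exprn_ge0].
have [M [M0 hM _]] := nat_above (x := A' * (D' ^ 2)%:R / eps + D'%:R)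
   (addr_ge0 (divr_ge0 (mulr_ge0 A'0 (ler0n _ _)) (ltW eps0)) (ler0n _ _)).
have hM1 : A' * (D' ^ 2)%:R / eps <= M%:R by apply: le_trans hM; rewrite lerDl.
have hM2 : (D' <= M)%N.
  rewrite -(ler_nat R); apply: le_trans hM.
  by rewrite lerDr divr_ge0 ?(ltW eps0) // mulr_ge0.
exists (2 * (n * M) + E2 + M.*2)%N.
apply: (@truncated_penalized R n m g r r0 E2 c (tdeg p) A A eps eps lam k M) => //.
- move=> i; apply: box_expansionW (hg i) => //; exact: leq_maxr.
- move=> I; apply: truncatedW (hI I); exact: leq_maxl.
- move=> x bx; have := box_expansion_bound r0 hexp bx.
  by rewrite ler_norml => /andP[].
- move=> x bx; have [//|[i|] /= hi] := heps x bx; first by right; exists i.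
  by left; move: hi; rewrite mevalN lerN2.
- by rewrite /lam divfK // gt_eqF.
- by move: hk; rewrite ler_pdivrMr // [k%:R * _]mulrC.
- by apply: leq_trans hM2 _; lia.
- by move: hM1; rewrite ler_pdivrMr // [M%:R * _]mulrC.
Qed.

(** With p0 = N - sum_j X_j ^ 2, the set of the a + b p0 with a and b sums of squares
    is closed under multiplication, because p0 ^ 2 is a square.  It contains
    r ^ 2 - X_i ^ 2 = (r ^ 2 - N) + sum_(j != i) X_j ^ 2 + p0 when r ^ 2 >= N, for
    instance when r = N + 1. *)
Lemma ball_box_product : archimedean_module (quadratic_module g) ->
  exists2 r : R, 0 < r & exists E, forall I, TM E (box_product r I).
Proof.
move=> [N hN]; set p0 := _ - _ in hN.
have [k0 hk0] := quadratic_module_truncated hN.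
pose T p := exists a b, [/\ SOS a, SOS b & p = a + b * p0].
have T1 : T 1 by exists 1, 0; split; [exact: sos1 | exact: sos0 | rewrite mul0r addr0].
have T_mul p q : T p -> T q -> T (p * q).
  move=> [a [b [sa sb ->]]] [a' [b' [sa' sb' ->]]].
  exists (a * a' + b * b' * p0 ^+ 2), (a * b' + b * a'); split; last by ring.
    apply: sosD; first exact: sosM.
    by rewrite mulrC; apply: sos_sqrM; exact: sosM.
  by apply: sosD; exact: sosM.
exists (N.+1)%:R; first by rewrite ltr0n.
apply: truncated_uniform => I.
have [a [b [sa sb ->]]] : T (box_product (N.+1)%:R I).
  apply: (big_ind T) => // i _.
  exists (((N.+1)%:R ^+ 2 - N%:R)%:MP + \sum_(j | j != i) 'X_j ^+ 2), 1.
  split; last first.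
  - rewrite mul1r /p0 [X in _ = _ + (_ - X)](bigD1 i) //= raddfB /= mpolyC_nat.
    ring.
  - exact: sos1.
  - apply: sosD.
      by apply: sosC; rewrite subr_ge0 -natrX ler_nat; lia.
    apply: (big_ind SOS); [exact: sos0 | exact: sosD |].
    by move=> j _; exact: sos_sqr.
exists (tdeg a + (tdeg b + k0))%N; apply: truncatedD.
  by apply: truncated_sos => //; rewrite leq_addr.
apply: truncatedW (leq_addl _ _) _.
exact: truncated_sosM.
Qed.

(** The 1 - X_i ^ 2 are positive on the basic set, so their products are covered by
    the certificates on a large box. *)
Lemma unit_box_product : archimedean_module (quadratic_module g) ->
  basic_set g `<=` @open_cube R n ->
  exists E, forall I, TM E (box_product 1 I).
Proof.
move=> arch Scube; have [r r0 [E hE]] := ball_box_product arch.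
apply: truncated_uniform => I; apply: (putinar_of_box r0 hE) => x _ /Scube cx.
rewrite rmorph_prod; apply: prodr_gt0 => i _ /=.
rewrite mevalB mevalC rmorphXn /= mevalXU.
by have /andP[h1 h2] := cx i; nra.
Qed.

End Archimedean.

(** * Degree of the certificate *)

Section Quantitative.
Variable R : realType.

Section UnitBox.
Variable n : nat.
Implicit Types p : {mpoly R[n]}.

Lemma box1_norm (x : 'I_n -> R) i : box 1 x -> `|x i| <= 1.
Proof. by move=> bx; rewrite ler_norml; exact: bx. Qed.

Lemma meval_le_coef_norm p (x : 'I_n -> R) : box 1 x ->
  `|p.@[x]| <= coef_norm p.
Proof.
move=> bx; rewrite mevalE; apply: (le_trans (ler_norm_sum _ _ _)).
apply: ler_sum => a _; rewrite normrM ler_piMr //.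
apply: norm_prod_le1 => i; rewrite normrX exprn_ile1 //; exact: box1_norm.
Qed.

Lemma dist_exp_le (a b : R) k : `|a| <= 1 -> `|b| <= 1 ->
  `|a ^+ k - b ^+ k| <= k%:R * `|a - b|.
Proof.
move=> ha hb; elim: k => [|k IH]; first by rewrite !expr0 subrr normr0 mul0r.
rewrite !exprS; apply: (le_trans (dist_mul_le1 _ _ ha _)).
  by rewrite normrX exprn_ile1.
by rewrite -natr1 mulrDl mul1r addrC lerD2r.
Qed.

(** Each monomial a is Lipschitz with constant mdeg a on the unit box, for the
    maximum norm. *)
Lemma meval_lipschitz p (x y : 'I_n -> R) (h : R) : 0 <= h ->
  box 1 x -> box 1 y -> (forall i, `|x i - y i| <= h) ->
  `|p.@[x] - p.@[y]| <= (tdeg p)%:R * coef_norm p * h.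
Proof.
move=> h0 bx by_ hxy; rewrite !mevalE -sumrB.
apply: (le_trans (ler_norm_sum _ _ _)).
rewrite mulrAC mulr_sumr big_seq [leRHS]big_seq; apply: ler_sum => a ap.
rewrite -mulrBr normrM mulrC ler_wpM2r //.
apply: (le_trans (dist_prod_le1 _ _ _)).
- by move=> i; rewrite normrX exprn_ile1 // box1_norm.
- by move=> i; rewrite normrX exprn_ile1 // box1_norm.
apply: (@le_trans _ _ (\sum_(i < n) (a i)%:R * h)).
  apply: ler_sum => i _; apply: (le_trans (dist_exp_le _ _ _)).
  - exact: box1_norm.
  - exact: box1_norm.
  - by rewrite ler_wpM2l.
by rewrite -mulr_suml -natr_sum -mdegE ler_wpM2r // ler_nat mdeg_le_tdeg.
Qed.

Lemma sqdist_coord_le (x y : 'I_n -> R) (h : R) : 0 <= h ->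
  sqdist x y <= h ^+ 2 -> forall i, `|x i - y i| <= h.
Proof.
move=> h0 hxy i.
rewrite -(ler_pXn2r (ltn0Sn 1)) ?nnegrE // real_normK ?num_real //.
apply: le_trans hxy; rewrite /sqdist (bigD1 i) //= lerDl.
by apply: sumr_ge0 => j _; exact: sqr_ge0.
Qed.

End UnitBox.

Lemma natexp_le_expR (k D : nat) (s : R) : D%:R <= s ->
  (k.+1)%:R ^+ D <= expR (k%:R * s).
Proof.
move=> Ds; apply: (@le_trans _ _ (expR k%:R ^+ D)).
  by rewrite lerXn2r ?nnegrE ?expR_ge0 // -natr1 addrC expR_ge1Dx.
by rewrite -expRM_natl ler_expR mulrC ler_wpM2l.
Qed.

(** The left-hand side bounds half the order of the Bernstein expansion.  With
    x = exp s, all of s, t, l, D, k and D' are at most x, and both 3 ^ D and 4 ^ k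
    are at most x ^ 3. *)
Lemma certificate_size (s t l : R) (D k D' : nat) : 1 <= s ->
  0 <= t <= s -> 0 <= l <= s -> D%:R <= s -> k%:R <= s -> D'%:R <= s ->
  2 * (3 ^+ D * t + l * 4 ^+ k) * (D' ^ 2)%:R + D'%:R + 1 <= 5 * expR (6 * s).
Proof.
move=> s1 /andP[t0 ts] /andP[l0 ls] Ds ks D's.
pose x := expR s.
have x1 : 1 <= x by rewrite -expR0 ler_expR; lra.
have xs : s + 1 <= x by rewrite addrC expR_ge1Dx.
have e6 : expR (6 * s) = x ^+ 6 by rewrite -expRM_natl.
have h3 : 3 ^+ D <= x ^+ 3.
  apply: (le_trans (natexp_le_expR 2 Ds)); rewrite -expRM_natl ler_expR.
  by rewrite ler_wpM2r //; [lra | rewrite ler_nat].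
have h4 : 4 ^+ k <= x ^+ 3.
  by apply: (le_trans (natexp_le_expR 3 ks)); rewrite -expRM_natl.
have x3 : 1 <= x ^+ 3 by rewrite exprn_ege1.
have A1 : 3 ^+ D * t <= x ^+ 3 * x by apply: ler_pM => //; lra.
have A2 : l * 4 ^+ k <= x * x ^+ 3 by apply: ler_pM => //; lra.
have D2 : (D' ^ 2)%:R <= x ^+ 2.
  by rewrite natrX lerXn2r ?nnegrE //; lra.
have A3 : 2 * (3 ^+ D * t + l * 4 ^+ k) * (D' ^ 2)%:R <= 4 * x ^+ 4 * x ^+ 2.
  apply: ler_pM => //.
    by rewrite mulr_ge0 // addr_ge0 // mulr_ge0 // exprn_ge0.
  have -> : 4 * x ^+ 4 = 2 * (x ^+ 3 * x + x * x ^+ 3) by ring.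
  by rewrite ler_pM2l // lerD.
have A4 : x <= x ^+ 6 by rewrite -{1}[x]expr1 ler_weXn2l.
have E6 : 4 * x ^+ 4 * x ^+ 2 = 4 * x ^+ 6 by ring.
by rewrite e6; rewrite E6 in A3; lra.
Qed.

(** The choices made here: lam is the least value that compensates for
    - t <= p when delta = (a t ^ K)^-1 and nu = 1/2, then k is proportional to
    lam m and M is determined by the resulting coefficient sum.  Thus lam m, k and
    D + (2 k + 1) E are at most a constant times t ^ (K + 1), and only 3 ^ D and 4 ^ k
    are exponential. *)
Lemma certificate_parameters (a : R) (n m E K : nat) : 0 < a ->
  exists2 C : R, 0 < C & forall (t b lam : R) (D : nat),
    2 <= t -> D%:R <= t -> 0 <= b <= t -> lam = (t + 2^-1) * (a * t ^+ K) ->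
    exists k M : nat,
      [/\ (0 < k)%N, (0 < M)%N, lam * m%:R <= 2^-1 * k%:R,
          (D + (k.*2).+1 * E <= M)%N &
          (3 ^+ D * b + lam * m%:R * 4 ^+ k) * ((D + (k.*2).+1 * E) ^ 2)%:R
             <= 2^-1 * M%:R /\
          (2 * (n * M) + E + M.*2)%:R <= C * expR (C * t ^+ K.+1)].
Proof.
move=> a0; pose b := 2 * a * m%:R.
have b0 : 0 <= b by rewrite mulr_ge0 //; lra.
have ER : 0 <= E%:R :> R by [].
have nR : 0 <= (2 * n + 2)%:R :> R by [].
pose c1 := 1 + (2 * b + 1) + (4 * b + 3) * E%:R.
have c1_ge1 : 1 <= c1.
  have : 0 <= (4 * b + 3) * E%:R by rewrite mulr_ge0 //; lra.
  by rewrite /c1; lra.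
have [C [C0 hC1 hC2]] : exists C : R,
    [/\ 0 < C, (2 * n + 2)%:R * 5 + E%:R <= C & 6 * c1 <= C].
  by exists ((2 * n + 2)%:R * 5 + E%:R + 6 * c1); split; lra.
exists C => // t nb lam D t2 dt /andP[nb0 nbt] lamE {C0}.
move: c1_ge1 hC2; rewrite {}/c1 => c1_ge1 hC2.
have tK : 0 <= t ^+ K by rewrite exprn_ge0 //; lra.
have l0 : 0 <= lam * m%:R.
  rewrite lamE mulr_ge0 // mulr_ge0 //; first by lra.
  by rewrite mulr_ge0 // ltW.
have lu : lam * m%:R <= b * t ^+ K.+1.
  have -> : b * t ^+ K.+1 = (2 * t) * (a * t ^+ K) * m%:R.
    by rewrite /b exprS; ring.
  rewrite lamE ler_wpM2r // ler_wpM2r //; first by rewrite mulr_ge0 // ltW.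
  by lra.
have tu : t <= t ^+ K.+1 by rewrite -{1}[t]expr1 ler_weXn2l //; lra.
move: l0 lu tu {tK a0 lamE}; move: (lam * m%:R) (t ^+ K.+1) => l u l0 lu tu {lam}.
move: b b0 lu hC2 c1_ge1 => {a} b b0 lu hC2 c1_ge1.
(* From here on only l = lam m and u = t ^ (K + 1) matter. *)
have [k [k_gt0 hk1 hk2]] := nat_above (x := 2 * l) (mulr_ge0 (ler0n _ 2) l0).
exists k.
have u1 : 1 <= u by lra.
have ku : k%:R <= (2 * b + 1) * u by rewrite mulrDl; lra.
set D' := (D + (k.*2).+1 * E)%N.
have D'u : D'%:R <= u + (4 * b + 3) * E%:R * u.
  have -> : D'%:R = D%:R + (2 * k%:R + 1) * E%:R :> R.
    by rewrite /D' natrD natrM -natr1 -mul2n natrM.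
  have : (2 * k%:R + 1) * E%:R <= ((4 * b + 3) * u) * E%:R.
    by rewrite ler_wpM2r //; rewrite mulrDl in ku *; lra.
  by lra.
have bu : 0 <= b * u by rewrite mulr_ge0 //; lra.
have bEu : 0 <= (4 * b + 3) * E%:R * u by rewrite !mulr_ge0 //; lra.
pose s := u + (2 * b + 1) * u + (4 * b + 3) * E%:R * u.
have A0 : 0 <= 3 ^+ D * nb by rewrite mulr_ge0 // exprn_ge0.
have A'0 : 0 <= 3 ^+ D * nb + l * 4 ^+ k.
  by rewrite addr_ge0 // mulr_ge0 // exprn_ge0.
have s1 : 1 <= s by rewrite /s; lra.
have hsize := @certificate_size s nb l D k D' s1.
have {}hsize : 2 * (3 ^+ D * nb + l * 4 ^+ k) * (D' ^ 2)%:R + D'%:R + 1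
    <= 5 * expR (6 * s).
  apply: hsize; rewrite /s.
  - by rewrite nb0 /=; lra.
  - by rewrite l0 /=; lra.
  - lra.
  - lra.
  - lra.
move: hsize A'0; move: (3 ^+ D * nb + l * 4 ^+ k) => {A0} A' hsize A'0.
have x0 : 0 <= 2 * A' * (D' ^ 2)%:R by rewrite mulr_ge0 // mulr_ge0.
have [M [M0 hM1 hM2]] := nat_above (addr_ge0 x0 (ler0n R D')).
have D'0 : 0 <= D'%:R :> R by [].
exists M; split=> //.
- by lra.
- by rewrite -(ler_nat R); lra.
split; first by lra.
have -> : (2 * (n * M) + E + M.*2)%:R = (2 * n + 2)%:R * M%:R + E%:R :> R.
  by rewrite -natrM -natrD; congr _%:R; rewrite mulnDl -mulnA -mul2n addnAC.
have MB : M%:R <= 5 * expR (6 * s) by lra.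
have x1 : 1 <= expR (6 * s) by rewrite -[leLHS]expR0 ler_expR; lra.
apply: (@le_trans _ _ (((2 * n + 2)%:R * 5 + E%:R) * expR (6 * s))).
  rewrite mulrDl; apply: lerD; last by rewrite ler_peMr.
  by rewrite -mulrA ler_wpM2l.
apply: ler_pM; rewrite ?expR_ge0 //.
rewrite ler_expR.
have -> : 6 * s = 6 * (1 + (2 * b + 1) + (4 * b + 3) * E%:R) * u by rewrite /s; ring.
by rewrite ler_wpM2r //; lra.
Qed.

Variables (n m : nat) (g : m.-tuple {mpoly R[n]}).

(** Where p < 1/2, the distance to the basic set is at least h = 1 / (2 t ^ 2);
    the Lojasiewicz inequality applied with s = h ^ 2 gives the violation e below,
    whose inverse is a constant times t ^ (4 k0). *)
Lemma constraint_violation (c : R) : 0 < c ->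
  basic_set g !=set0 -> basic_set g `<=` box 1 ->
  exists K, exists2 a : R, 0 < a & forall (t : R) p, 2 <= t ->
    (tdeg p)%:R <= t -> coef_norm p <= t ->
    (forall x, basic_set g x -> 1 <= p.@[x]) ->
    forall x, box 1 x ->
      2^-1 <= p.@[x] \/ exists i, (c *: tnth g i).@[x] <= - (a * t ^+ K)^-1.
Proof.
move=> c0 S0 Sbox; have [k0 [C0 C0_gt0 hloj]] := lojasiewicz S0 Sbox.
have C1 : 0 < 2 * (C0 + 1) by lra.
exists (4 * k0)%N; exists (2 * (C0 + 1) / c * 4 ^+ k0).
  by rewrite mulr_gt0 ?exprn_gt0 // divr_gt0.
move=> t p t2 dt nt p1 x bx.
have t0 : 0 < t by lra.
have n0 : 0 <= coef_norm p by exact: coef_norm_ge0.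
pose h := (2 * t ^+ 2)^-1.
have tt : 0 < t ^+ 2 by rewrite exprn_gt0.
have t21 : 1 <= t ^+ 2 by rewrite exprn_ege1 //; lra.
have h0 : 0 < h by rewrite invr_gt0 mulr_gt0.
have h1 : h <= 1 by rewrite invf_le1 ?mulr_gt0 //; lra.
have [?|px] := leP 2^-1 p.@[x]; [by left | right].
(* The Lipschitz constant of p is at most t ^ 2, so p varies by at most 1/2
   between x and a point of the basic set closer than h. *)
have far y : basic_set g y -> h ^+ 2 <= sqdist x y.
  move=> Sy; rewrite leNgt; apply/negP => /ltW hxy.
  have := meval_lipschitz p (ltW h0) bx (Sbox _ Sy) (sqdist_coord_le (ltW h0) hxy).
  have : (tdeg p)%:R * coef_norm p * h <= t * t * h.
    by rewrite ler_wpM2r ?(ltW h0) // ler_pM.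
  have -> : t * t * h = 2^-1 by rewrite /h; field; rewrite gt_eqF.
  by have := p1 _ Sy; rewrite ler_norml => ? ? /andP[]; lra.
pose e := (h ^+ 2) ^+ k0 / (2 * (C0 + 1)).
have hk0 : 0 < (h ^+ 2) ^+ k0 by rewrite !exprn_gt0.
have e0 : 0 < e by rewrite divr_gt0.
have e1 : e <= 1.
  rewrite ler_pdivrMr // mul1r; apply: (@le_trans _ _ 1); last by lra.
  by rewrite !exprn_ile1 // ?exprn_ge0 // ltW.
have -> : (2 * (C0 + 1) / c * 4 ^+ k0 * t ^+ (4 * k0))^-1 = c * e.
  have -> : e = (4 ^+ k0 * t ^+ (4 * k0))^-1 / (2 * (C0 + 1)).
    rewrite /e /h !exprVn; congr (_^-1 / _).
    have -> : (2 * t ^+ 2) ^+ 2 = 4 * t ^+ 4 by ring.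
    by rewrite exprMn -exprM.
  have n1 : 4 ^+ k0 != 0 :> R by rewrite expf_neq0 // pnatr_eq0.
  have n2 : t ^+ (4 * k0) != 0 by rewrite expf_neq0 // gt_eqF.
  by field; rewrite n1 n2 !gt_eqF //; lra.
apply: contrapT => /forallNP hg.
have : (h ^+ 2) ^+ k0 <= C0 * e.
  apply: (hloj x) => //; first by rewrite e0.
    by rewrite exprn_ge0 // ltW.
  move=> i; have /negP := hg i; rewrite -ltNge mevalZ -mulrN.
  by rewrite ltr_pM2l // => /ltW.
rewrite /e mulrA ler_pdivlMr //.
by rewrite [C0 * _]mulrC ler_pM2l //; lra.
Qed.

Lemma putinar_degree_bound : archimedean_module (quadratic_module g) ->
  basic_set g !=set0 -> basic_set g `<=` @open_cube R n ->
  exists K, exists2 C : R, 0 < C & forall (t : R) p, 2 <= t ->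
    (tdeg p)%:R <= t -> coef_norm p <= t ->
    (forall x, basic_set g x -> 1 <= p.@[x]) ->
    exists2 N : nat, N%:R <= C * expR (C * t ^+ K) &
      truncated_quadratic_module g N%:R p.
Proof.
move=> arch S0 Scube.
have Sbox : basic_set g `<=` box 1.
  by move=> x /Scube cx i; have /andP[h1 h2] := cx i; rewrite !ltW.
have [E1 hE1] := unit_box_product arch Scube.
have [c c0 [E2 hE2]] := scaled_constraints g (ltr01 : 0 < 1 :> R).
have [K [a a0 hviol]] := constraint_violation c0 S0 Sbox.
have [C C0 hC] := certificate_parameters n m (maxn E1 E2) K a0.
exists K.+1; exists C => // t p t2 dt nt p1.
have nb : 0 <= coef_norm p <= t by rewrite coef_norm_ge0.
have tK : 0 < t ^+ K by rewrite exprn_gt0 // (lt_le_trans _ t2).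
have lam0 : 0 <= (t + 2^-1) * (a * t ^+ K).
  by rewrite mulr_ge0 ?(ltW (mulr_gt0 a0 tK)) //; lra.
have tA x : box 1 x -> - t <= p.@[x].
  by move=> bx; have := meval_le_coef_norm p bx; rewrite ler_norml => /andP[]; lra.
have hexp : box_expansion 1 (tdeg p) (3 ^+ tdeg p * coef_norm p) p.
  by apply: box_expansion_mpoly => //; lra.
move: (maxn E1 E2) (leq_maxl E1 E2) (leq_maxr E1 E2) hC => E E1E E2E hC.
have [k [M [k0 M0 hk hM [hA hN]]]] := hC t (coef_norm p) _ (tdeg p) t2 dt nb erefl.
exists (2 * (n * M) + E + M.*2)%N; first exact: hN.
apply: (@truncated_penalized R n m g 1 ltr01 E c (tdeg p)
  (3 ^+ tdeg p * coef_norm p) t 2^-1 (a * t ^+ K)^-1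
  ((t + 2^-1) * (a * t ^+ K)) k M p c0).
- by move=> i; exact: box_expansionW (hE2 i).
- by move=> I; exact: truncatedW (hE1 I).
- exact: hexp.
- by rewrite mulr_ge0 ?exprn_ge0 //; case/andP: nb.
- by rewrite invr_gt0.
- by rewrite invr_gt0 mulr_gt0.
- exact: lam0.
- exact: k0.
- exact: M0.
- exact: tA.
- by move=> x; exact: hviol.
- by rewrite mulfK // gt_eqF // mulr_gt0.
- exact: hk.
- by apply: (leq_trans hM); rewrite -addnn leq_addr.
- exact: hA.
Qed.

End Quantitative.

(** * The multinomial norm *)

Section MultinomialNorm.
Variables (R : realType) (n : nat).
Implicit Types (p q : {mpoly R[n]}) (a b : 'X_{1..n}).

Definition coef_nonneg p := forall a, 0 <= p@_a.

Lemma coef_nonnegM p q : coef_nonneg p -> coef_nonneg q -> coef_nonneg (p * q).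
Proof.
by move=> hp hq a; rewrite mcoeffM; apply: sumr_ge0 => k _; rewrite mulr_ge0.
Qed.

Lemma coef_nonneg_sum I (s : seq I) (F : I -> {mpoly R[n]}) :
  (forall i, coef_nonneg (F i)) -> coef_nonneg (\sum_(i <- s) F i).
Proof. by move=> hF a; rewrite raddf_sum; apply: sumr_ge0 => i _; exact: hF. Qed.

Lemma coef_nonnegX a : coef_nonneg 'X_[a].
Proof. by move=> b; rewrite mcoeffX. Qed.

(** By the multinomial theorem its coefficient at a is the multinomial coefficient
    of a when a has degree j; evaluating at (1, ..., 1) then bounds sums of
    multinomial coefficients. *)
Definition var_sum_exp j : {mpoly R[n]} := (\sum_i 'X_i) ^+ j.

Lemma coef_nonneg_var_sum_exp j : coef_nonneg (var_sum_exp j).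
Proof.
rewrite /var_sum_exp; elim: j => [|j IH]; first by rewrite expr0 -mpolyX0; exact: coef_nonnegX.
rewrite exprS; apply: coef_nonnegM => //; apply: coef_nonneg_sum => i.
exact: coef_nonnegX.
Qed.

Lemma multinomial_coef_gt0 a : 0 < multinomial_coef R a.
Proof.
rewrite /multinomial_coef divr_gt0 ?ltr0n ?fact_gt0 //.
by apply: prodr_gt0 => i _; rewrite ltr0n fact_gt0.
Qed.

Lemma multinomial_coefD1 a i :
  (mdeg a).+1%:R * multinomial_coef R a =
  (a i).+1%:R * multinomial_coef R (U_(i) + a)%MM.
Proof.
rewrite /multinomial_coef mdegD mdeg1 add1n factS natrM.
rewrite (bigD1 i) //= [in RHS](bigD1 i) //= mnmDE mnm1E eqxx add1n factS natrM.
have -> : \prod_(j < n | j != i) ((U_(i) + a)%MM j)`!%:R =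
          \prod_(j < n | j != i) (a j)`!%:R :> R.
  by apply: eq_bigr => j ji; rewrite mnmDE mnm1E eq_sym (negPf ji).
set P := \prod_(j < n | _) _.
have P0 : P != 0.
  by rewrite gt_eqF //; apply: prodr_gt0 => j _; rewrite ltr0n fact_gt0.
have a0 : (a i)`!%:R != 0 :> R by rewrite pnatr_eq0 -lt0n fact_gt0.
have s0 : (a i).+1%:R != 0 :> R by rewrite pnatr_eq0.
move: P0 a0 s0; move: P (a i)`!%:R (a i).+1%:R (mdeg a).+1%:R => P w z y P0 w0 z0.
by field; rewrite P0 w0 z0.
Qed.

(** The inequality is enough here and follows by induction on the degree from the
    recurrence [multinomial_coefD1], divided by the degree and summed over i. *)
Lemma multinomial_coef_le a : multinomial_coef R a <= (var_sum_exp (mdeg a))@_a.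
Proof.
move ej : (mdeg a) => j; elim: j a ej => [|j IH] a aj.
  move/eqP: aj; rewrite mdeg_eq0 => /eqP ->.
  rewrite /var_sum_exp expr0 /multinomial_coef mdeg0 fact0 mcoeff1 eqxx big1.
    by rewrite divr1.
  by move=> i _; rewrite mnm0E fact0.
rewrite /var_sum_exp exprS mulr_suml raddf_sum /=.
have -> : multinomial_coef R a =
    \sum_(i < n) (a i)%:R / j.+1%:R * multinomial_coef R a.
  rewrite -mulr_suml -mulr_suml -natr_sum -mdegE aj divff ?mul1r //.
apply: ler_sum => i _; have [ai|ai] := posnP (a i).
  rewrite ai !mul0r; apply: coef_nonnegM; first exact: coef_nonnegX.
  exact: coef_nonneg_var_sum_exp.
have ea : a = (U_(i) + (a - U_(i)))%MM.
  by apply/mnmP => l; rewrite mnmDE mnmBE mnm1E; case: eqP => [<-|_]; lia.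
move: (a - U_(i))%MM ea => b ea; rewrite ea in aj ai *.
have bj : mdeg b = j by move: aj; rewrite mdegD mdeg1; lia.
rewrite [in leRHS]mulrC mcoeffMX; apply: le_trans (IH _ bj).
rewrite mnmDE mnm1E eqxx add1n mulrAC -multinomial_coefD1 bj.
by rewrite mulrAC divff ?mul1r // pnatr_eq0.
Qed.

Lemma coef_le_poly_norm p a : a \in msupp p ->
  `|p@_a| <= poly_norm p * multinomial_coef R a.
Proof.
move=> ap; rewrite -ler_pdivrMr ?multinomial_coef_gt0 // /poly_norm.
exact: (le_bigmax_seq 0 a xpredT (fun a => `|p@_a| / multinomial_coef R a)).
Qed.

Lemma poly_norm_ge0 p : 0 <= poly_norm p.
Proof. by rewrite /poly_norm; apply: bigmax_ge_id. Qed.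

(** The coefficients of q outside s are nonnegative, and q(1, ..., 1) is the sum of
    all coefficients. *)
Lemma sum_coef_le (s : seq 'X_{1..n}) q : uniq s -> coef_nonneg q ->
  \sum_(a <- s) q@_a <= q.@[fun=> 1].
Proof.
move=> us hq; rewrite mevalE.
have -> : \sum_(a <- msupp q) q@_a * \prod_(i < n) 1 ^+ a i =
          \sum_(a <- msupp q) q@_a.
  by apply: eq_bigr => a _; rewrite big1 ?mulr1 // => i _; rewrite expr1n.
rewrite (bigID (mem (msupp q))) /= [X in _ + X]big1 ?addr0; last first.
  by move=> a /memN_msupp_eq0.
rewrite -big_filter.
have -> : \sum_(a <- msupp q) q@_a =
   \sum_(a <- msupp q | a \in s) q@_a + \sum_(a <- msupp q | a \notin s) q@_a.
  by rewrite (bigID (mem s)).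
rewrite -[X in _ <= X + _]big_filter.
have -> : \sum_(a <- [seq x <- s | x \in msupp q]) q@_a =
          \sum_(a <- [seq x <- msupp q | x \in s]) q@_a.
  apply: perm_big; apply: uniq_perm; rewrite ?filter_uniq ?msupp_uniq //.
  by move=> a; rewrite !mem_filter andbC.
by rewrite lerDl; apply: sumr_ge0 => a _; exact: hq.
Qed.

Lemma coef_norm_le_poly_norm p :
  coef_norm p <= (\sum_(j < (tdeg p).+1) n%:R ^+ j) * poly_norm p.
Proof.
pose q : {mpoly R[n]} := \sum_(j < (tdeg p).+1) var_sum_exp j.
have hq : coef_nonneg q.
  by apply: coef_nonneg_sum => j; exact: coef_nonneg_var_sum_exp.
have -> : \sum_(j < (tdeg p).+1) n%:R ^+ j = q.@[fun=> 1].
  rewrite raddf_sum; apply: eq_bigr => j _ /=; rewrite rmorphXn raddf_sum /=.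
  congr (_ ^+ _); under eq_bigr do rewrite mevalXU.
  by rewrite sumr_const card_ord.
apply: (@le_trans _ _ (\sum_(a <- msupp p) q@_a * poly_norm p)); last first.
  by rewrite -mulr_suml ler_wpM2r ?poly_norm_ge0 // sum_coef_le // msupp_uniq.
rewrite /coef_norm big_seq [leRHS]big_seq; apply: ler_sum => a ap.
apply: (le_trans (coef_le_poly_norm ap)); rewrite mulrC.
rewrite ler_wpM2r ?poly_norm_ge0 //; apply: (le_trans (multinomial_coef_le a)).
have ad : (mdeg a < (tdeg p).+1)%N by rewrite ltnS mdeg_le_tdeg.
rewrite /q raddf_sum /= (bigD1 (Ordinal ad)) //= lerDl.
by apply: sumr_ge0 => j _; exact: coef_nonneg_var_sum_exp.
Qed.

Lemma coef_norm_le_degree p : (0 < n)%N -> (0 < tdeg p)%N ->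
  coef_norm p <= 2 * (tdeg p)%:R * n%:R ^+ tdeg p * poly_norm p.
Proof.
move=> n0 d0; apply: (le_trans (coef_norm_le_poly_norm p)).
rewrite ler_wpM2r ?poly_norm_ge0 //.
have n1 : 1 <= n%:R :> R by rewrite ler1n.
apply: (@le_trans _ _ (\sum_(j < (tdeg p).+1) n%:R ^+ tdeg p)).
  by apply: ler_sum => j _; rewrite ler_weXn2l // -ltnS.
rewrite sumr_const card_ord -[leLHS]mulr_natl ler_wpM2r ?exprn_ge0 //.
by rewrite -natrM ler_nat; lia.
Qed.

Lemma coef_normD_le p q : coef_norm (p + q) <= coef_norm p + coef_norm q.
Proof.
have E (s : seq 'X_{1..n}) (r : {mpoly R[n]}) : uniq s -> {subset msupp r <= s} ->
    coef_norm r = \sum_(a <- s) `|r@_a|.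
  move=> us hs; rewrite [RHS](bigID (mem (msupp r))) /= [X in _ + X]big1 ?addr0.
    rewrite -big_filter; apply: perm_big; apply: uniq_perm.
    - exact: msupp_uniq.
    - exact: filter_uniq.
    - by move=> a; rewrite mem_filter; have := hs a; case: (a \in msupp r) => //= ->.
  by move=> a /memN_msupp_eq0 ->; rewrite normr0.
pose s := undup (msupp p ++ msupp q).
have us : uniq s by exact: undup_uniq.
rewrite (E s p) // ?(E s q) // ?(E s (p + q)) //.
- rewrite -big_split /=; apply: ler_sum => a _; rewrite mcoeffD; exact: ler_normD.
- by move=> a /msuppD_le; rewrite mem_undup.
- by move=> a aq; rewrite mem_undup mem_cat aq orbT.
- by move=> a ap; rewrite mem_undup mem_cat ap.
Qed.

Lemma coef_normC (c : R) : coef_norm (c%:MP : {mpoly R[n]}) = `|c|.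
Proof.
have [->|c0] := eqVneq c 0; first by rewrite /coef_norm mpolyC0 msupp0 big_nil normr0.
by rewrite /coef_norm msuppC (negPf c0) big_seq1 mcoeffC eqxx mulr1.
Qed.

Lemma coef_normZ (c : R) p : c != 0 -> coef_norm (c *: p) = `|c| * coef_norm p.
Proof.
move=> c0; rewrite /coef_norm mulr_sumr.
rewrite (perm_big _ (msuppZ _ c0)); apply: eq_bigr => a _.
by rewrite mcoeffZ normrM.
Qed.

Lemma coef_norm_gt0 p : p != 0 -> 0 < coef_norm p.
Proof.
move=> p0; rewrite lt_neqAle coef_norm_ge0 andbT eq_sym; apply/eqP => h.
case/negP: p0; rewrite -msupp_eq0; case E : (msupp p) => [//|a s].
have : a \in msupp p by rewrite E mem_head.
rewrite mcoeff_msupp -normr_gt0 => ha.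
move: h; rewrite /coef_norm E big_cons => h.
have : 0 <= \sum_(b <- s) `|p@_b| by apply: sumr_ge0.
lra.
Qed.

End MultinomialNorm.

(** * The error bound *)

Section LowerBound.
Variables (R : realType) (n m : nat) (g : m.-tuple {mpoly R[n]}).

Lemma sos_lower_bound_gap (f : {mpoly R[n]}) (fmin err k : R) :
  is_minimum (basic_set g) f fmin ->
  truncated_quadratic_module g k ((f - fmin%:MP) + err%:MP) ->
  (0 <= fmin%:E - sos_lower_bound g f k <= err%:E)%E.
Proof.
move=> [[x Sx fx] _] hT.
have ub : (sos_lower_bound g f k <= fmin%:E)%E.
  apply: ge_ereal_sup => _ [a ha <-]; rewrite lee_fin.
  by have := truncated_ge0 ha Sx; rewrite mevalB mevalC fx subr_ge0.
have lb : ((fmin - err)%:E <= sos_lower_bound g f k)%E.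
  apply: ereal_sup_ubound; exists (fmin - err) => //=.
  by rewrite (_ : _ - _ = (f - fmin%:MP) + err%:MP) // raddfB /= opprB addrA addrAC.
move: (sos_lower_bound g f k) ub lb => [r| |] //.
by rewrite !lee_fin => h1 h2; apply/andP; split; lra.
Qed.

End LowerBound.

(** The constants C and 3 ^ K in the exponent are absorbed by raising the power of t,
    which is at least 2. *)
Lemma expR_power_dominates (R : realType) (C : R) (K : nat) : 0 < C ->
  exists2 c : R, 0 < c & forall t : R, 2 <= t ->
    C * expR (C * (3 * t) ^+ K) <= c * expR (t `^ c).
Proof.
move=> C0; have x0 : 0 <= C * 3 ^+ K by rewrite mulr_ge0 ?exprn_ge0 // ltW.
have [q [_ hq _]] := nat_above x0.
have h2q : C * 3 ^+ K <= 2 ^+ q.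
  by apply: (le_trans hq); rewrite -natrX ler_nat ltnW // ltn_expl.
exists (C + (K + q)%:R); first by rewrite ltr_wpDr.
move=> t t2; have t0 : 0 <= t by lra.
apply: ler_pM; rewrite ?expR_ge0 ?(ltW C0) //; first by rewrite lerDl.
rewrite ler_expR; apply: (@le_trans _ _ (t ^+ (K + q))).
  rewrite exprMn mulrA exprD mulrC ler_wpM2l ?exprn_ge0 //.
  by apply: (le_trans h2q); rewrite lerXn2r ?nnegrE.
rewrite -powR_mulrn //; apply: ler_powR; first lra.
by rewrite lerDr ltW.
Qed.

Theorem theorem8 (R : realType) (n m : nat) (n_ge1 : (1 <= n)%N)
    (g : m.-tuple {mpoly R[n]})
    (arch_g : archimedean_module (quadratic_module g))
    (S_neq0 : basic_set g !=set0)
    (S_cube : basic_set g `<=` @open_cube R n) :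
  exists2 c : R, 0 < c &
    forall (f : {mpoly R[n]}) (d : nat) (fmin : R) (k : int),
      tdeg f = d ->
      is_minimum (basic_set g) f fmin ->
      c * expR ((2 * d%:R ^+ 2 * n%:R ^+ d) `^ c) < k%:~R ->
      let err : R :=
        (6 * d%:R ^+ 3 * n%:R ^+ (2 * d) * poly_norm f)
          / (ln (k%:~R / c) `^ c^-1) in
      truncated_quadratic_module g k%:~R ((f - fmin%:MP) + err%:MP) /\
      (0 <= fmin%:E - sos_lower_bound g f k%:~R <= err%:E)%E.
Proof.
have [K [C C0 hC]] := putinar_degree_bound arch_g S_neq0 S_cube.
have [c c0 hc] := expR_power_dominates K C0.
exists c => // f d fmin k df fmin_min hk err.
suff hT : truncated_quadratic_module g k%:~R ((f - fmin%:MP) + err%:MP).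
  by split=> //; exact: sos_lower_bound_gap.
have [[x0 Sx0 fx0] fmin_le] := fmin_min.
have kR : 0 < k%:~R :> R by apply: lt_trans hk; rewrite mulr_gt0 ?expR_gt0.
have [j kj] : exists j : nat, k%:~R = j%:R :> R.
  by move: kR; rewrite ltr0z; case: (k) => // j _; exists j.
rewrite kj in hk kR err *.
(* In degree 0 the error vanishes, but then so does f - fmin. *)
have [d0|d_gt0] := posnP d.
  have -> : err = 0 by rewrite /err d0 expr0n /= mulr0 !mul0r.
  have fC : f = (f@_0)%:MP.
    by apply: msize1_polyC; move: df; rewrite d0 /tdeg; move: (msize f) => -[|[]].
  have -> : f - fmin%:MP + 0%:MP = 0.
    by rewrite mpolyC0 addr0 -fx0 fC mevalC subrr.
  exact: truncated0.
have n1 : 1 <= n%:R :> R by rewrite ler1n.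
have d1 : 1 <= d%:R :> R by rewrite ler1n.
have nd1 : 1 <= n%:R ^+ d :> R by rewrite exprn_ege1.
(* The hypothesis on k says that tau > T, where T >= 2 dominates the degree. *)
pose T : R := 2 * d%:R ^+ 2 * n%:R ^+ d.
have d2 : d%:R <= d%:R ^+ 2 :> R by rewrite expr2 ler_peMr.
have dT : 2 * d%:R <= T.
  apply: (@le_trans _ _ (2 * d%:R ^+ 2)); first by rewrite ler_pM2l.
  by rewrite /T ler_peMr // mulr_ge0 // exprn_ge0.
have T2 : 2 <= T by lra.
have TcL : T `^ c < ln (j%:R / c).
  by rewrite -[ltLHS]expRK ltr_ln ?posrE ?expR_gt0 ?divr_gt0 // ltr_pdivlMr // mulrC.
have L0 : 0 < ln (j%:R / c) by apply: le_lt_trans TcL; exact: powR_ge0.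
pose tau := ln (j%:R / c) `^ c^-1.
have tau_c : tau `^ c = ln (j%:R / c).
  by rewrite /tau -powRrM mulVf ?gt_eqF // powRr1 // ltW.
have Ttau : T < tau.
  have : (T `^ c) `^ c^-1 < tau.
    by apply: gt0_ltr_powR; rewrite ?invr_gt0 // nnegrE ?powR_ge0 // ltW.
  by rewrite -powRrM divff ?gt_eqF // powRr1 //; lra.
have tau0 : 0 < tau by lra.
have kE : c * expR (tau `^ c) = j%:R.
  by rewrite tau_c lnK ?posrE ?divr_gt0 // mulrC divfK // gt_eqF.
pose F := coef_norm f.
have f0 : f != 0.
  by apply: contraTneq d_gt0 => f0; rewrite -df f0 -mpolyC0 tdegC.
have F0 : 0 < F by exact: coef_norm_gt0.
have hF : F <= 2 * d%:R * n%:R ^+ d * poly_norm f.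
  by have := @coef_norm_le_degree R n f n_ge1; rewrite df; apply.
have err_tau : err * tau = 6 * d%:R ^+ 3 * n%:R ^+ (2 * d) * poly_norm f.
  by rewrite /err divfK // gt_eqF.
(* This is where the shape of the error term is used: the coefficient
   sum of f is at most tau / 3 after division by err. *)
have hF3 : 3 * F <= err * tau.
  have -> : err * tau =
      3 * (2 * d%:R * n%:R ^+ d * poly_norm f * (d%:R ^+ 2 * n%:R ^+ d)).
    by rewrite err_tau mulnC exprM; ring.
  rewrite ler_pM2l //; apply: (le_trans hF); rewrite ler_peMr //.
    by apply: le_trans hF; exact: ltW.
  by apply: mulr_ege1 => //; rewrite exprn_ege1.
have err0 : 0 < err by rewrite -(pmulr_lgt0 _ tau0); lra.
pose p : {mpoly R[n]} := (f - fmin%:MP) + err%:MP.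
have Sbox x : basic_set g x -> box 1 x.
  by move=> /S_cube cx i; have /andP[h1 h2] := cx i; rewrite !ltW.
have fminF : `|fmin| <= F by rewrite -fx0; apply: meval_le_coef_norm; exact: Sbox.
have pF : coef_norm p <= F + `|fmin| + err.
  rewrite /p -mpolyCN; apply: (le_trans (coef_normD_le _ _)).
  rewrite coef_normC (gtr0_norm err0) lerD2r.
  by apply: (le_trans (coef_normD_le _ _)); rewrite coef_normC normrN.
have [N hN hTN] : exists2 N : nat, N%:R <= C * expR (C * (3 * tau) ^+ K) &
    truncated_quadratic_module g N%:R (err^-1 *: p).
  apply: hC; first lra.
  - apply: (@le_trans _ _ d%:R); last lra.
    rewrite ler_nat; apply: (leq_trans (tdegZ_le _ _)).
    by rewrite !tdegD_le // ?tdegN ?tdegC ?df.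
  - rewrite coef_normZ ?invr_eq0 ?gt_eqF // gtr0_norm ?invr_gt0 //.
    by rewrite mulrC ler_pdivrMr //; nra.
  - move=> x Sx; rewrite mevalZ mulrC ler_pdivlMr // mul1r.
    by rewrite /p mevalD mevalB !mevalC; have := fmin_le x Sx; lra.
have -> : f - fmin%:MP + err%:MP = err *: (err^-1 *: p).
  by rewrite scalerA divff ?gt_eqF // scale1r.
apply: truncatedZ; first exact: ltW.
apply: truncatedW hTN; rewrite -(ler_nat R); apply: (le_trans hN).
by rewrite -kE; apply: hc; lra.
Qed.
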